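(* Let $M$ be a strongly noetherian gcd-monoid with finitely many basic elements, and assume that there exists a Turing-computable map $f:\mathcal{F}_M\to\mathbb{N}$ such that $\mathcal{R}$-reduction is semi-convergent for $M$ up to $f$-padding. Then the word problem of the enveloping group $\mathcal{U}(M)$ is decidable.
   Context: Gcd-monoids. For $a,b$ in a monoid $M$, $a$ left-divides $b$ if $b=ax$ for some $x\in M$ (right-divides if $b=xa$). A left-gcd of $a,b$ is a common left-divisor that every common left-divisor of $a,b$ left-divides; right-gcds are symmetric. $M$ is a gcd-monoid if it is cancellative, $1$ is its only invertible element, and any two elements admit a left-gcd and a right-gcd. In a gcd-monoid, two elements $a,b$ with a common right-multiple (resp. left-multiple) admit a least one, the right-lcm $a\vee b$ (resp. left-lcm $a\mathbin{\widetilde\vee}b$). An atom of $M$ is an element (different from $1$) not expressible as $ab$ with $a,b\ne1$. When $a\vee b$ exists, $a\backslash b$ is defined by $a(a\backslash b)=a\vee b$; when $a\mathbin{\widetilde\vee}b$ exists, $a/b$ is defined by $(a/b)b=a\mathbin{\widetilde\vee}b$. A right-basic (resp. left-basic) element is one obtained from atoms by (repeatedly) using the operation $\backslash$ (resp. $/$). ''Finitely many basic elements'' means finitely many right-basic and left-basic elements. $M$ is strongly noetherian if there is a map $\lambda$ from $M\setminus\{1\}$ to the positive integers with $\lambda(ab)\ge\lambda(a)+\lambda(b)$. Multifractions. $\mathcal{U}(M)$ is the enveloping group of $M$ and $\iota:M\to\mathcal{U}(M)$ the canonical morphism. A multifraction of depth $n$ on $M$ is a finite sequence $\underline a=a_1/\cdots/a_n$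 of elements of $M$; it represents the element $\iota(\underline a)=\iota(a_1)\iota(a_2)^{-1}\iota(a_3)\cdots\iota(a_n)^{(-1)^{n-1}}$ of $\mathcal{U}(M)$. $\mathcal{F}_M$ is the set of all multifractions on $M$; $\underline1_n$ is the depth-$n$ multifraction with all entries $1$, and $\underline1$ denotes $\underline1_n$ for the appropriate $n$. $\underline1_{2p}/\underline a$ is obtained from $\underline a$ by adding $2p$ trivial entries on the left. $\mathcal{R}$-reduction. For multifractions $\underline a,\underline b$ of the same depth $n$, $1\le i<n$ and $x\in M$, write $\underline a\bullet R_{i,x}=\underline b$ if $b_k=a_k$ for $k\ne i-1,i,i+1$ and there is $x'\in M$ with: for $i$ even: $b_{i-1}=a_{i-1}x'$, $xb_i=a_ix'=x\vee a_i$, $xb_{i+1}=a_{i+1}$; for $i\ge3$ odd: $b_{i-1}=x'a_{i-1}$, $b_ix=x'a_i=x\mathbin{\widetilde\vee}a_i$, $b_{i+1}x=a_{i+1}$; for $i=1$: $b_1x=a_1$, $b_2x=a_2$. Write $\underline a\Rightarrow\underline b$ if $\underline a\bullet R_{i,x}=\underline b$ for some $i$ and some $x\ne1$; $\Rightarrow^*$ is the reflexive-transitive closure of $\Rightarrow$. For $f:\mathcal{F}_M\to\mathbb{N}$, $\mathcal{R}$-reduction is semi-convergent for $M$ up to $f$-padding if $\underline1_{2f(\underline a)}/\underline a\Rightarrow^*\underline1$ holds for every multifraction $\underline a$ on $M$ that represents $1$ in $\mathcal{U}(M)$. Computability. Under the assumptions, the atom set $S$ of $M$ is finite, $M$ has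 a finite presentation in terms of $S$, and each element of $M$ is represented by only finitely many words in $S$. A map on $\mathcal{F}_M$ is Turing-computable if it is induced by a Turing-computable map on sequences of words in $S$. The word problem of $\mathcal{U}(M)$ is the problem of deciding whether a word in $S\cup\overline S$ (with $\overline S$ the set of formal inverses of $S$) represents $1$ in $\mathcal{U}(M)$. *)

(* Defs.v *)
From Stdlib Require Import Relation_Operators.
From mathcomp Require Import all_boot.

Set Implicit Arguments.
Unset Strict Implicit.
Unset Printing Implicit Defensive.

Local Open Scope group_scope.

Section GcdMonoids.

Variable M : monoidType.
Implicit Types a b c d e m x : M.

Definition left_divides a b := exists x, b = a * x.
Definition right_divides a b := exists x, b = x * a.

Definition is_left_gcd d a b :=
  [/\ left_divides d a, left_divides d b &
      forall e, left_divides e a -> left_divides e b -> left_divides e d].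

Definition is_right_gcd d a b :=
  [/\ right_divides d a, right_divides d b &
      forall e, right_divides e a -> right_divides e b -> right_divides e d].

Definition invertible x := exists y : M, x * y = 1 /\ y * x = 1.

Definition cancellative :=
  (forall a b c, a * b = a * c -> b = c) /\
  (forall a b c, b * a = c * a -> b = c).

Definition gcd_monoid :=
  [/\ cancellative,
      forall x, invertible x -> x = 1,
      forall a b, exists d, is_left_gcd d a b &
      forall a b, exists d, is_right_gcd d a b].

(* [is_right_lcm m a b] says that m is the least common right-multiple of a
   and b, for left-divisibility; [is_left_lcm] is its mirror image. *)
Definition is_right_lcm m a b :=
  [/\ left_divides a m, left_divides b m &
      forall e, left_divides a e -> left_divides b e -> left_divides m e].

Definition is_left_lcm m a b :=
  [/\ right_divides a m, right_divides b m &
      forall e, right_divides a e -> right_divides b e -> right_divides m e].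

Definition atom a :=
  a <> 1 /\ forall b c, a = b * c -> b = 1 \/ c = 1.

(* The graphs of the partial operations a \ b and a / b. *)
Definition is_under a b c := is_right_lcm (a * c) a b.
Definition is_over a b c := is_left_lcm (c * b) a b.

Inductive right_basic : M -> Prop :=
| right_basic_atom a : atom a -> right_basic a
| right_basic_under a b c :
    right_basic a -> right_basic b -> is_under a b c -> right_basic c.

Inductive left_basic : M -> Prop :=
| left_basic_atom a : atom a -> left_basic a
| left_basic_over a b c :
    left_basic a -> left_basic b -> is_over a b c -> left_basic c.

Definition finitely_many_basic :=
  (exists s : seq M, forall x, right_basic x -> x \in s) /\
  (exists s : seq M, forall x, left_basic x -> x \in s).

(* lambda is only meaningful away from 1: its value at 1 is unconstrained. *)
Definition strongly_noetherian :=
  exists lambda : M -> nat,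
    (forall a, a <> 1 -> (0 < lambda a)%N) /\
    (forall a b, a <> 1 -> b <> 1 -> (lambda a + lambda b <= lambda (a * b)%g)%N).

End GcdMonoids.

Definition is_enveloping_group (M : monoidType) (U : groupType)
    (iota : M -> U) : Prop :=
  monoid_morphism iota /\
  forall (G : groupType) (phi : M -> G), monoid_morphism phi ->
    exists psi : U -> G,
      [/\ monoid_morphism psi,
          forall x, psi (iota x) = phi x &
          forall psi' : U -> G, monoid_morphism psi' ->
            (forall x, psi' (iota x) = phi x) -> forall u, psi' u = psi u].

Section Multifractions.

Variable M : monoidType.
Implicit Types (a b : seq M) (x y : M).

(* The multifraction a_1/.../a_n is the sequence [:: a_1; ...; a_n]. *)

Fixpoint alternating_product (U : groupType) (iota : M -> U) (inverted : bool)
    (a : seq M) : U :=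
  if a is x :: a' then
    (if inverted then (iota x)^-1 else iota x) *
      alternating_product iota (~~ inverted) a'
  else 1.

Definition mf_value (U : groupType) (iota : M -> U) a : U :=
  alternating_product iota false a.

(* Entries are numbered from 1; the dummy head fills position 0. *)
Definition entry a k : M := nth 1 (1 :: a) k.

Definition R_step (i : nat) (x : M) a b : Prop :=
  [/\ size b = size a,
      (1 <= i < size a)%N,
      forall k, k != i.-1 -> k != i -> k != i.+1 -> entry b k = entry a k &
      if i == 1%N then
        entry b 1 * x = entry a 1 /\ entry b 2 * x = entry a 2
      else if odd i then
        exists x' : M,
          [/\ entry b i.-1 = x' * entry a i.-1,
              entry b i * x = x' * entry a i,
              is_left_lcm (x' * entry a i) x (entry a i) &
              entry b i.+1 * x = entry a i.+1]
      else
        exists x' : M,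
          [/\ entry b i.-1 = entry a i.-1 * x',
              x * entry b i = entry a i * x',
              is_right_lcm (entry a i * x') x (entry a i) &
              x * entry b i.+1 = entry a i.+1]].

Definition R_red a b : Prop := exists i x, x <> 1 /\ R_step i x a b.

Definition R_reds : seq M -> seq M -> Prop := clos_refl_trans (seq M) R_red.

Definition ones n : seq M := nseq n 1.

Definition semi_convergent_up_to_padding (U : groupType) (iota : M -> U)
    (f : seq M -> nat) : Prop :=
  forall a, mf_value iota a = 1 ->
    R_reds (ones (2 * f a)%N ++ a) (ones (2 * f a + size a)%N).

End Multifractions.

(* Deterministic Turing machines with finitely many two-way infinite tapes,
   input alphabet A and output alphabet B. Cells hold an [option tm_symbol],
   None being the blank. *)

Inductive tm_move := MoveLeft | Stay | MoveRight.

Record turing_machine (A B : finType) := TuringMachine {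
  tm_aux_tapes : nat;
  tm_state : finType;
  tm_symbol : finType;
  tm_in : A -> tm_symbol;
  tm_out : B -> tm_symbol;
  tm_in_inj : injective tm_in;
  tm_out_inj : injective tm_out;
  tm_start : tm_state;
  tm_final : pred tm_state;
  tm_trans : tm_state -> {ffun 'I_tm_aux_tapes.+1 -> option tm_symbol} ->
             tm_state *
             {ffun 'I_tm_aux_tapes.+1 -> option tm_symbol * tm_move}
}.

Section Runs.

Variables A B : finType.
Variable T : turing_machine A B.

(* A tape is a pair (l, r): l lists the cells to the left of the head, nearest
   first, and r lists the cells from the scanned one rightwards; all cells
   beyond these two lists are blank. *)
Definition tape := (seq (option (tm_symbol T)) * seq (option (tm_symbol T)))%type.

Definition tape_read (t : tape) : option (tm_symbol T) := head None t.2.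

Definition tape_act (t : tape) (act : option (tm_symbol T) * tm_move) : tape :=
  let: (l, r) := t in
  let: (c, mv) := act in
  match mv with
  | MoveLeft => (behead l, head None l :: c :: behead r)
  | Stay => (l, c :: behead r)
  | MoveRight => (c :: l, behead r)
  end.

Definition tm_config :=
  (tm_state T * {ffun 'I_(tm_aux_tapes T).+1 -> tape})%type.

Definition tm_step (c : tm_config) : tm_config :=
  let: (q, ts) := c in
  if tm_final q then c else
  let: (q', acts) := tm_trans q [ffun j => tape_read (ts j)] in
  (q', [ffun j => tape_act (ts j) (acts j)]).

(* Tape 0 initially carries the input word, with the head on its first letter;
   the other tapes are blank. *)
Definition tm_init (w : seq A) : tm_config :=
  (tm_start T,
   [ffun j => ([::], if j == ord0 then [seq Some (tm_in T x) | x <- w] else [::])]).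

Fixpoint until_blank (r : seq (option (tm_symbol T))) : seq (tm_symbol T) :=
  if r is Some x :: r' then x :: until_blank r' else [::].

(* The output is read on tape 0, from the head up to the first blank. *)
Definition tm_output (c : tm_config) : seq (tm_symbol T) :=
  until_blank (c.2 ord0).2.

Definition tm_computes (w : seq A) (v : seq B) : Prop :=
  exists t : nat, let c := iter t tm_step (tm_init w) in
    tm_final c.1 /\ tm_output c = [seq tm_out T y | y <- v].

End Runs.

Definition turing_computable (X Y : Type) (A B : finType)
    (encX : X -> seq A) (encY : Y -> seq B) (F : X -> Y) : Prop :=
  exists T : turing_machine A B, forall x, tm_computes T (encX x) (encY (F x)).

Definition unary (n : nat) : seq unit := nseq n tt.

(* A finite sequence of words is encoded as a word by ending each of its terms
   with the additional letter None. *)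
Definition encode_words (A : finType) (ws : seq (seq A)) : seq (option A) :=
  flatten [seq rcons [seq Some x | x <- w] None | w <- ws].

Section Algorithms.

Variable M : monoidType.

Definition enumerates_atoms (k : nat) (s : 'I_k -> M) : Prop :=
  injective s /\ forall x, atom x <-> exists i, x = s i.

Definition word_value (k : nat) (s : 'I_k -> M) (w : seq 'I_k) : M :=
  \prod_(i <- w) s i.

Definition mf_turing_computable (f : seq M -> nat) : Prop :=
  exists (k : nat) (s : 'I_k -> M), enumerates_atoms s /\
  exists F : seq (seq 'I_k) -> nat,
    (forall ws, F ws = f [seq word_value s w | w <- ws]) /\
    turing_computable (@encode_words 'I_k) unary F.

(* A word in S and its formal inverses is a sequence of pairs (i, e), where
   (i, false) stands for s i and (i, true) for its formal inverse. *)
Definition signed_word_value (U : groupType) (iota : M -> U)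
    (k : nat) (s : 'I_k -> M) (w : seq ('I_k * bool)) : U :=
  \prod_(p <- w) (if p.2 then (iota (s p.1))^-1 else iota (s p.1)).

Definition word_problem_decidable (U : groupType) (iota : M -> U) : Prop :=
  exists (k : nat) (s : 'I_k -> M), enumerates_atoms s /\
  exists chi : seq ('I_k * bool) -> bool,
    (forall w, chi w <-> signed_word_value iota s w = 1) /\
    turing_computable id (fun b : bool => [:: b]) chi.

End Algorithms.

(* Main.v *)
(* Every entry of a multifraction is written as a word in the atoms, and it suffices to reduce with atoms x.
   To compute the lcm of x with a word, a token moves through the word, replacing the current value t by
   s \ t when it crosses the atom s; all these values are basic elements, so the moves form a finite table.
   A reduction at position i makes entry i + 1 a proper divisor of itself and does not change the later
   entries, hence by strong noetherianity the tree of all reductions of a multifraction is finite. A Turing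
   machine can thus turn a signed word w into a multifraction a, compute f(a), pad, and explore the whole
   tree for the trivial multifraction: semi-convergence says that it is found whenever w represents 1, and
   the converse holds since reductions preserve the value in the group. The tree is explored depth first,
   by running again from the root with a recorded sequence of choices, so that a single copy of the initial
   multifraction is enough. *)

From Stdlib Require Import Operators_Properties Classical FunctionalExtensionality.
Require Import Defs.
From mathcomp Require Import all_boot.

Set Implicit Arguments.
Unset Strict Implicit.
Unset Printing Implicit Defensive.

Local Open Scope group_scope.

(** * Divisibility in gcd-monoids *)

(** The obstacle is that no step may compare two words as elements of M. The tests made by the
    search avoid this: an entry is trivial only if its word is empty; an atom divides an entry
    exactly when its token leaves the word with value 1; the existence of an lcm is read off the
    table of token moves. Words for one element may differ, so an arbitrary reduction is followed
    through values only, with the words that the search itself produces. Reading the even entries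
    backwards, and reversing those on the left of the position, makes both neighbours of a position
    start with the letters on which a reduction acts. The two mirror-image rules then become one
    rule, in M or in its opposite monoid, and inversion in the group is a morphism from the opposite
    monoid. The rule for i = 1 is the odd rule with x' = 1, since no entry can absorb x'. The table
    is chosen classically over a finite index set: only the existence of a machine is claimed. *)

Section SidedDivisibility.

Variable M : monoidType.
Implicit Types (e : bool) (a b c d m x y z : M).

(* The two sides are treated at once: for e = true everything takes place in the opposite monoid. *)
Definition smul e a b := if e then b * a else a * b.
Definition sdvd e a b := exists x, b = smul e a x.
Definition slcm e m a b :=
  [/\ sdvd e a m, sdvd e b m &
      forall c, sdvd e a c -> sdvd e b c -> sdvd e m c].
Definition sbasic e a := if e then left_basic a else right_basic a.

Lemma smulA e a b c : smul e a (smul e b c) = smul e (smul e a b) c.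
Proof. by case: e; rewrite /= mulgA. Qed.

Lemma smul1x e a : smul e 1 a = a.
Proof. by case: e; rewrite /= (mulg1, mul1g). Qed.

Lemma smulx1 e a : smul e a 1 = a.
Proof. by case: e; rewrite /= (mulg1, mul1g). Qed.

Lemma smulC e a b : smul (~~ e) a b = smul e b a.
Proof. by case: e. Qed.

Lemma sdvd_refl e a : sdvd e a a.
Proof. by exists 1; rewrite smulx1. Qed.

Lemma sdvd_mulr e a b : sdvd e a (smul e a b).
Proof. by exists b. Qed.

Lemma sdvd_trans e a b c : sdvd e a b -> sdvd e b c -> sdvd e a c.
Proof. by move=> [x ->] [y ->]; exists (smul e x y); rewrite smulA. Qed.

Lemma slcm_sym e m a b : slcm e m a b -> slcm e m b a.
Proof. by move=> [? ? H]; split=> // c ? ?; apply: H. Qed.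

Lemma sbasic_atom e a : atom a -> sbasic e a.
Proof. by case: e => Ha; [apply: left_basic_atom | apply: right_basic_atom]. Qed.

Lemma sbasic_under e a b c :
  sbasic e a -> sbasic e b -> slcm e (smul e a c) a b -> sbasic e c.
Proof.
case: e => Ha Hb Hc.
  by apply: (left_basic_over Hb Ha); exact: (@slcm_sym true _ _ _ Hc).
exact: right_basic_under Ha Hb Hc.
Qed.

Section Gcd.

Hypothesis M_gcd : gcd_monoid M.
Variable lam : M -> nat.
Hypothesis lam_lt : forall e a b, a <> 1 -> (lam b < lam (smul e a b))%N.

Lemma smulI e a : injective (smul e a).
Proof. by case: M_gcd => [[H1 H2] _ _ _] x y; case: e => /=; [apply: H2 | apply: H1]. Qed.

(** By cancellation a one-sided inverse is two-sided, and 1 is the only invertible element. *)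
Lemma smul_conical e a b : smul e a b = 1 -> a = 1 /\ b = 1.
Proof.
case: M_gcd => _ Hinv _ _ H.
have Hba : smul e b a = 1 by apply: (@smulI e a); rewrite smulA H smul1x smulx1.
have Ha : a = 1 by apply: Hinv; exists b; case: e H Hba.
by split=> //; rewrite Ha smul1x in H.
Qed.

Lemma sdvd_antisym e a b : sdvd e a b -> sdvd e b a -> a = b.
Proof.
move=> [x ->] [y]; rewrite -smulA -{1}(smulx1 e a) => /smulI /esym /smul_conical [-> _].
by rewrite smulx1.
Qed.

Lemma slcm_uniq e m m' a b : slcm e m a b -> slcm e m' a b -> m = m'.
Proof. by move=> [? ? H1] [? ? H2]; apply: (@sdvd_antisym e); [apply: H1 | apply: H2]. Qed.

Lemma slcm_dvd e a b : sdvd e a b -> slcm e b a b.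
Proof. by move=> H; split=> //; apply: sdvd_refl. Qed.

Lemma sgcd_exists e a b : exists d,
  [/\ sdvd e d a, sdvd e d b & forall c, sdvd e c a -> sdvd e c b -> sdvd e c d].
Proof. by case: M_gcd => _ _ Hl Hr; case: e; [apply: Hr | apply: Hl]. Qed.

(* A common multiple of minimal weight [lam] is an lcm: its gcd with another common multiple is a common
   multiple too, so it is not a proper divisor. *)
Lemma slcm_exists e a b c : sdvd e a c -> sdvd e b c -> exists m, slcm e m a b.
Proof.
have [n] := ubnP (lam c); elim: n => // n IH in c * => /ltnSE Hn Ha Hb.
case: (classic (exists2 d, sdvd e a d /\ sdvd e b d & (lam d < lam c)%N)).
  by move=> [d [Hda Hdb] Hd]; apply: (IH d) => //; apply: leq_trans Hn.
move=> Hmin; exists c; split=> // d Had Hbd.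
have [g [[x Hx] Hgd Hg]] := sgcd_exists e c d.
case: (eqVneq x 1) => [x1 | /eqP x1]; first by rewrite Hx x1 smulx1.
case: Hmin; exists g; first by split; apply: Hg.
(* The cofactor x multiplies g on the far side, so the weight inequality is used for [~~ e]. *)
by rewrite Hx -(smulC e); apply: lam_lt.
Qed.

(** This is a \ (bc) = (a \ b) \ c: a common multiple of a and bc is a multiple of the lcm of a and
    b, and cancelling b leaves a common multiple of a \ b and c. A token can therefore cross a word
    letter by letter. *)
Lemma slcm_mulr e a b c a' m :
  slcm e (smul e b a') a b -> slcm e (smul e c m) a' c ->
  slcm e (smul e (smul e b c) m) a (smul e b c).
Proof.
move=> [[a1 Ha1] _ Hab] [[c1 Hc1] _ Hac]; rewrite -smulA; split.
- by rewrite Hc1 smulA Ha1 -smulA; apply: sdvd_mulr.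
- by rewrite smulA; apply: sdvd_mulr.
move=> d Had [d' Hd]; have [y Hy] : sdvd e (smul e b a') d.
  by apply: Hab => //; rewrite Hd -smulA; apply: sdvd_mulr.
have Hyd : smul e c d' = smul e a' y by apply: (@smulI e b); rewrite !smulA -Hd.
have [z Hz] : sdvd e (smul e c m) (smul e c d').
  by apply: Hac; [rewrite Hyd |]; apply: sdvd_mulr.
by exists z; rewrite Hd -!smulA; congr smul; rewrite Hz smulA.
Qed.

Section Words.

Variables (k : nat) (s : 'I_k -> M).
Hypothesis s_atoms : enumerates_atoms s.

(** For e = true the head of u is the rightmost factor in M, so in both cases divisors on side e
    meet the head of the word first. *)
Definition sprod e (u : seq 'I_k) : M := foldr (fun i => smul e (s i)) 1 u.

Lemma sprod_cat e u v : sprod e (u ++ v) = smul e (sprod e u) (sprod e v).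
Proof. by elim: u => [|i u IH] /=; rewrite ?smul1x // IH smulA. Qed.

Lemma sprod_rev e u : sprod e (rev u) = sprod (~~ e) u.
Proof.
elim: u => //= i u IH; rewrite rev_cons -cats1 sprod_cat IH /= smulx1.
by rewrite smulC.
Qed.

Lemma sprod_revN e u : sprod (~~ e) (rev u) = sprod e u.
Proof. by rewrite sprod_rev negbK. Qed.

Lemma s_atom i : atom (s i).
Proof. by apply/s_atoms.2; exists i. Qed.

(** This lets a machine recognize a trivial entry without solving the word problem of M. *)
Lemma sprod_eq1 e u : sprod e u = 1 -> u = [::].
Proof. by case: u => //= i u /smul_conical [/(s_atom i).1]. Qed.

(** A nontrivial element that is not an atom splits into two factors of smaller weight. *)
Lemma atom_words e x : exists u, sprod e u = x.
Proof.
suff [u Hu] : exists u, sprod false u = x.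
  by exists (if e then rev u else u); case: e; rewrite // sprod_rev.
have [n] := ubnP (lam x); elim: n => // n IH in x * => /ltnSE Hn.
case: (classic (x = 1)) => [->|x1]; first by exists [::].
case: (classic (atom x)) => [/s_atoms.2 [i ->]|xNatom].
  by exists [:: i]; rewrite /= mulg1.
have [b [c [Hx Hb Hc]]] : exists b c, [/\ x = b * c, b <> 1 & c <> 1].
  apply: NNPP => H; apply: xNatom; split=> // b c Hx.
  by apply: NNPP => /not_or_and [Hb Hc]; apply: H; exists b, c.
have [u Hu] : exists u, sprod false u = b.
  by apply: IH; apply: leq_trans Hn; rewrite Hx; apply: (lam_lt true).
have [v Hv] : exists v, sprod false v = c.
  by apply: IH; apply: leq_trans Hn; rewrite Hx; apply: (lam_lt false).
by exists (u ++ v); rewrite sprod_cat Hu Hv Hx.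
Qed.

End Words.
End Gcd.
End SidedDivisibility.

(** * Searching for a reduction *)

(* Entries are words in the atoms, the even ones being read backwards. A state is a position between two
   entries: the entries to its left are listed from right to left, and each is read from right to left. *)
Section Search.

Variables (I Tk : finType).
Variable tok : bool -> Tk -> I -> option (Tk * seq I).
Variable tk0 : I -> Tk.
Variable tk1 : pred Tk.
Variable expand : bool -> Tk -> seq I.

Implicit Types (e : bool) (t : Tk) (u v w : seq I) (ls rs ws : seq (seq I)).

(** For a correct table, the result on a token t and a word u is the token u \ t together with a
    word for t \ u. *)
Fixpoint sweep e t u : option (Tk * seq I) :=
  if u is i :: u' then
    if tok e t i is Some (t', w) then
      if sweep e t' u' is Some (t'', w') then Some (t'', w ++ w') else None
    else None
  else Some (t, [::]).

(* The reduction R_{i,x} for an atom x, at the position that follows entry i. *)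
Definition spawn e i ls rs : option (seq (seq I) * seq (seq I)) :=
  if (ls, rs) is (u :: ls', v :: rs') then
    if sweep e (tk0 i) v is Some (t, v') then
      if tk1 t then
        if sweep e (tk0 i) u is Some (t', u') then
          if ls' is u2 :: ls2 then
            Some (u' :: (rev (expand e t') ++ u2) :: ls2, v' :: rs')
          else if tk1 t' then Some ([:: u'], v' :: rs') else None
        else None
      else None
    else None
  else None.

Fixpoint rewind ls rs := if ls is u :: ls' then rewind ls' (rev u :: rs) else rs.

Definition state := option (seq (seq I) * seq (seq I)).

(** [None] marks an inner node of the tree; a failed reduction is a rejecting leaf, so that every
    choice is allowed everywhere. *)
Definition leaf (x : state) : option bool :=
  if x is Some (ls, rs) then if rs is [::] then Some (all (@nilp I) ls) else None
  else Some false.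

(* The choice [None] moves one entry to the right; [Some i] reduces and goes back to the left end. *)
Definition advance (x : state) (c : option I) : state :=
  if x is Some (ls, v :: rs) then
    if c is Some i then
      if spawn (odd (size ls)) i ls (v :: rs) is Some (ls', rs')
      then Some ([::], rewind ls' rs') else None
    else Some (rev v :: ls, rs)
  else None.

Lemma rewindE ls rs : rewind ls rs = rev (map rev ls) ++ rs.
Proof.
by elim: ls rs => //= u ls IH rs; rewrite IH rev_cons cat_rcons.
Qed.

End Search.

(** * Depth-first search by replaying recorded choices *)

Section Exploration.

Variables (X : Type) (K : eqType) (leaf : X -> option bool) (advance : X -> K -> X).

Inductive accepts (x : X) : Prop :=
| accepts_leaf : leaf x = Some true -> accepts x
| accepts_next c : leaf x = None -> accepts (advance x c) -> accepts x.

Definition child (y x : X) : Prop := leaf x = None /\ exists c, y = advance x c.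

Variables (c0 : K) (cs0 : seq K).
Let choices := c0 :: cs0.

(* [trial x C D b C']: in state x, after the choices C (latest first), a run that follows the choices D
   and then always c0 ends with result b after the choices C'. *)
Inductive trial (x : X) (C : seq K) : seq K -> bool -> seq K -> Prop :=
| trial_leaf b : leaf x = Some b -> trial x C [::] b C
| trial_recorded c D b C' :
    leaf x = None -> trial (advance x c) (c :: C) D b C' -> trial x C (c :: D) b C'
| trial_first b C' :
    leaf x = None -> trial (advance x c0) (c0 :: C) [::] b C' -> trial x C [::] b C'.

Definition choice_succ (c : K) : option K :=
  ohead (drop (index c choices).+1 choices).

(** C has the latest choice first, while choices to be replayed have the earliest first, hence the
    [rev]. [None] means that the whole tree has been explored. *)
Fixpoint backtrack (C : seq K) : option (seq K) :=
  if C is c :: C' then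
    if choice_succ c is Some c' then Some (rev (c' :: C')) else backtrack C'
  else None.

(** A relation, because the number of trials is not bounded by any structural recursion; termination
    is the content of [searches_explore]. *)
Inductive searches (x0 : X) (D : seq K) (b : bool) : Prop :=
| dfs_accept C : trial x0 [::] D true C -> b -> searches x0 D b
| dfs_reject C : trial x0 [::] D false C -> backtrack C = None -> ~~ b -> searches x0 D b
| dfs_retry C D' :
    trial x0 [::] D false C -> backtrack C = Some D' -> searches x0 D' b -> searches x0 D b.

Inductive reached (x0 : X) : seq K -> X -> Prop :=
| reached_nil : reached x0 [::] x0
| reached_rcons p x c :
    reached x0 p x -> leaf x = None -> reached x0 (rcons p c) (advance x c).

Lemma reached_trial x0 p x D b C :
  reached x0 p x -> trial x (rev p) D b C -> trial x0 [::] (p ++ D) b C.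
Proof.
move=> H; elim: H D => [//|q y c _ IH Hy D] Ht.
by rewrite cat_rcons; apply: IH; apply: trial_recorded => //; rewrite -rev_rcons.
Qed.

(** After its recorded choices a run takes c0 anyway, so recording that c0 changes nothing. *)
Lemma trial_first_explicit x0 p x b C :
  reached x0 p x -> leaf x = None ->
  trial x0 [::] (rcons p c0) b C -> trial x0 [::] p b C.
Proof.
move=> H Hx; rewrite -cats1 -[X in trial _ _ X b C -> _]/(p ++ _) -{2}[p]cats0.
suff aux y C1 D : trial y C1 (D ++ [:: c0]) b C -> 
    (foldl advance y D = x) -> trial y C1 (D ++ [::]) b C.
  move=> Ht; apply: aux Ht _; elim: H => [//|q y c _ IH Hy].
  by rewrite foldl_rcons IH.
elim: D y C1 => [|c D IH] y C1 /=.
  move=> Ht yx; move: Ht; rewrite yx => Ht; inversion Ht; subst.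
  exact: trial_first.
by move=> Ht E; inversion Ht; subst; apply: trial_recorded => //; apply: IH.
Qed.

Lemma dfs_first_explicit x0 p x b :
  reached x0 p x -> leaf x = None -> searches x0 (rcons p c0) b -> searches x0 p b.
Proof.
move=> Hp Hx [C Ht Hb | C Ht HC Hb | C D' Ht HC Hd].
- exact: dfs_accept (trial_first_explicit Hp Hx Ht) Hb.
- exact: dfs_reject (trial_first_explicit Hp Hx Ht) HC Hb.
- exact: dfs_retry (trial_first_explicit Hp Hx Ht) HC Hd.
Qed.

(** What remains of the search once the subtree reached by the choices C is exhausted. *)
Definition resumes (x0 : X) (C : seq K) (b : bool) : Prop :=
  if backtrack C is Some D then searches x0 D b else ~~ b.

Hypothesis choices_uniq : uniq choices.
Hypothesis choices_all : forall c, c \in choices.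

Lemma choice_succ_suffix pre c cs :
  choices = pre ++ c :: cs -> choice_succ c = ohead cs.
Proof.
move=> E; rewrite /choice_succ E; have := choices_uniq.
rewrite E cat_uniq /= negb_or => /and3P [_ /andP [Hc _] _].
rewrite index_cat (negPf Hc) /= eqxx addn0 -cat_rcons drop_cat size_rcons ltnn.
by rewrite subnn drop0.
Qed.

(** The invariant of the search: it either succeeds inside the subtree of x or leaves that subtree
    with nothing missed. The outer induction is on the tree, the inner one on the siblings still to
    be tried. *)
Lemma searches_explore x0 x p : Acc child x -> reached x0 p x ->
  (accepts x /\ searches x0 p true) \/
  (~ accepts x /\ forall b, resumes x0 (rev p) b -> searches x0 p b).
Proof.
move=> Hacc; elim: Hacc p => {}x _ IH p Hp.
case Hx : (leaf x) => [r|].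
  have Ht : trial x0 [::] p r (rev p).
    by rewrite -[X in trial _ _ X]cats0; apply: (reached_trial Hp); apply: trial_leaf.
  case: r Hx Ht => Hx Ht; first by left; split; [apply: accepts_leaf | apply: dfs_accept Ht _].
  right; split; first by case; rewrite Hx.
  rewrite /resumes => b; case E: (backtrack _) => [D|] Hb.
    exact: dfs_retry Ht E Hb.
  exact: dfs_reject Ht E Hb.
(* The choices in [pre] have been tried at x, and c is the next one. *)
suff: forall cs pre c, choices = pre ++ c :: cs ->
  (accepts x /\ searches x0 (rcons p c) true) \/
  ((forall c', c' \in c :: cs -> ~ accepts (advance x c')) /\
     forall b, resumes x0 (rev p) b -> searches x0 (rcons p c) b).
  move=> /(_ cs0 [::] c0 erefl) [[Ha Hd]|[Hn Hd]]; [left|right].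
    by split=> //; apply: (dfs_first_explicit Hp Hx Hd).
  split=> [[|c _]|b Hb]; rewrite ?Hx //; first exact: Hn.
  by apply: (dfs_first_explicit Hp Hx); apply: Hd.
elim=> [|c' cs IHcs] pre c E.
all: have Hc : reached x0 (rcons p c) (advance x c) by apply: reached_rcons.
all: have Hch : child (advance x c) x by split=> //; exists c.
all: case: (IH _ Hch _ Hc) => [[Ha Hd]|[Hn Hd]]; first by left; split=> //; apply: accepts_next Ha.
  right; split=> [c'|b Hb]; first by rewrite inE => /eqP ->.
  by apply: Hd; rewrite rev_rcons /resumes /= (choice_succ_suffix E).
have E' : choices = rcons pre c ++ c' :: cs by rewrite cat_rcons.
(* Once the subtree of c is exhausted, backtracking replaces c by its successor c'. *)
have Hresume b : searches x0 (rcons p c') b -> searches x0 (rcons p c) b.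
  move=> Hb; apply: Hd.
  by rewrite rev_rcons /resumes /= (choice_succ_suffix E) /= rev_cons revK.
case: (IHcs _ _ E') => [[Ha Hd']|[Hn' Hd']]; [left|right].
  by split=> //; apply: Hresume.
split=> [c''|b Hb]; last by apply/Hresume/Hd'.
by rewrite inE => /predU1P [->|]; [apply: Hn | apply: Hn'].
Qed.

Lemma searches_decides x0 : Acc child x0 ->
  exists2 b : bool, searches x0 [::] b & (b <-> accepts x0).
Proof.
move=> Hacc; case: (searches_explore Hacc (reached_nil x0)) => [[Ha Hd]|[Hn Hd]].
  by exists true.
by exists false; [apply: Hd | split].
Qed.

End Exploration.

(** * Sweeps compute lcms *)

Section SearchCorrectness.

Variable M : monoidType.
Hypothesis M_gcd : gcd_monoid M.
Variable lam : M -> nat.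
Hypothesis lam_lt : forall e a b, a <> 1 -> (lam b < lam (smul e a b))%N.
Variables (k : nat) (s : 'I_k -> M).
Hypothesis s_atoms : enumerates_atoms s.

Variables (Tk : finType) (tokv : Tk -> M).
Hypothesis tokv_basic : forall e x, sbasic e x -> exists t, tokv t = x.
Variable tok : bool -> Tk -> 'I_k -> option (Tk * seq 'I_k).
Hypothesis tok_some : forall e t i t' w, tok e t i = Some (t', w) ->
  smul e (tokv t) (sprod s e w) = smul e (s i) (tokv t') /\
  slcm e (smul e (s i) (tokv t')) (tokv t) (s i).
Hypothesis tok_none : forall e t i, tok e t i = None ->
  forall t' w, smul e (tokv t) (sprod s e w) = smul e (s i) (tokv t') ->
  ~ slcm e (smul e (s i) (tokv t')) (tokv t) (s i).
Variable tk0 : 'I_k -> Tk.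
Hypothesis tk0E : forall i, tokv (tk0 i) = s i.
Variable expand : bool -> Tk -> seq 'I_k.
Hypothesis expandE : forall e t, sprod s e (expand e t) = tokv t.

Let tk1 : pred Tk := fun t => tokv t == 1.
Let mspawn := spawn tok tk0 tk1 expand.
Let madvance := advance tok tk0 tk1 expand.
Let msweep := sweep tok.
Let maccepts := accepts (@leaf 'I_k) madvance.
Let mchild := child (@leaf 'I_k) madvance.
Local Notation pv := (sprod s).
Implicit Types (e : bool) (u v w : seq 'I_k) (ls rs ws : seq (seq 'I_k)).

Lemma sweep_eq e t u t' w : msweep e t u = Some (t', w) ->
  smul e (tokv t) (pv e w) = smul e (pv e u) (tokv t').
Proof.
rewrite /msweep; elim: u t t' w => [|i u IH] t t' w /=; first by move=> [<- <-]; rewrite smulx1 smul1x.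
case E: tok => [[t1 w1]|//]; case E2: (sweep tok e t1 u) => [[t2 w2]|//] [<- <-].
by rewrite sprod_cat smulA (tok_some E).1 -smulA (IH _ _ _ E2) smulA.
Qed.

(** Basic elements are closed under the operation \, so the token stays in the finite table all
    along the word. *)
Lemma sweep_lcm e t u m :
  sbasic e (tokv t) -> slcm e m (tokv t) (pv e u) ->
  exists t' w, msweep e t u = Some (t', w) /\ m = smul e (pv e u) (tokv t').
Proof.
move=> Ht Hm; suff [t' [w [E H]]] : exists t' w, msweep e t u = Some (t', w) /\
    slcm e (smul e (pv e u) (tokv t')) (tokv t) (pv e u).
  by exists t', w; split=> //; apply: slcm_uniq Hm H.
(* The induction carries a mere common multiple: cancelling one letter leaves a common multiple of
   the new token and the rest of the word. *)
have {m Hm} [m Htm Hum] : exists2 m, sdvd e (tokv t) m & sdvd e (pv e u) m.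
  by case: Hm => *; exists m.
elim: u t m Ht Htm Hum => [|i u IH] t m Ht Htm Hum /=.
  by exists t, [::]; rewrite smul1x; split=> //; apply/slcm_sym/slcm_dvd; exists (tokv t); rewrite smul1x.
have Him : sdvd e (s i) m by apply: sdvd_trans Hum; apply: sdvd_mulr.
have [n Hn] := slcm_exists M_gcd lam_lt Htm Him.
have [[c Hc] [y Hy] Hmin] := Hn.
have Hby : sbasic e y.
  apply: (sbasic_under (sbasic_atom e (s_atom s_atoms i)) Ht).
  by rewrite -Hy; apply: slcm_sym.
(* A missing table entry is impossible: the cofactor y is basic, hence the value of a token, and c
   is the value of some word. *)
case E: tok => [[t' w]|]; last first.
  have [t' Ht'] := tokv_basic Hby; have [w Hw] := atom_words lam_lt s_atoms e c.
  by case: (tok_none E (t' := t') (w := w)); rewrite Ht' ?Hw -?Hc -Hy.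
have [Eq Hl] := tok_some E.
have Hbt' : sbasic e (tokv t').
  by apply: (sbasic_under (sbasic_atom e (s_atom s_atoms i)) Ht); apply: slcm_sym.
case: Hum => x Hx; have [z Hz] : sdvd e (smul e (s i) (tokv t')) m.
  by case: Hl => _ _; apply.
have {Hx} Hx : smul e (tokv t') z = smul e (pv e u) x.
  by apply: (@smulI _ M_gcd e (s i)); rewrite !smulA -Hz Hx.
have [|t'' [w'' [-> Hl']]] := IH t' (smul e (tokv t') z) Hbt' (sdvd_mulr _ _ _).
  by rewrite Hx; apply: sdvd_mulr.
by exists t'', (w ++ w''); split=> //; apply: slcm_mulr Hl Hl'.
Qed.

Fixpoint entries e ws : seq M :=
  if ws is w :: ws' then pv e w :: entries (~~ e) ws' else [::].

Lemma size_entries e ws : size (entries e ws) = size ws.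
Proof. by elim: ws e => //= w ws IH e; rewrite IH. Qed.

Lemma entries_cat e ws ws' :
  entries e (ws ++ ws') = entries e ws ++ entries (odd (size ws) (+) e) ws'.
Proof. by elim: ws e => //= w ws IH e; rewrite IH addbN addNb. Qed.

Lemma entries_inv e ws a b : entries e ws = a ++ b -> exists ws1 ws2,
  [/\ ws = ws1 ++ ws2, entries e ws1 = a & entries (odd (size a) (+) e) ws2 = b].
Proof.
move=> H; exists (take (size a) ws), (drop (size a) ws).
have Hsz : size (take (size a) ws) = size a.
  by rewrite size_takel // -(size_entries e) H size_cat leq_addr.
move: H; rewrite -{1}(cat_take_drop (size a) ws) entries_cat Hsz => H.
rewrite cat_take_drop; split=> //.
  by have := congr1 (take (size a)) H; rewrite !take_size_cat ?size_entries.
by have := congr1 (drop (size a)) H; rewrite !drop_size_cat ?size_entries.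
Qed.

Lemma accepts_skip ls pre rs :
  maccepts (Some (rev (map rev pre) ++ ls, rs)) -> maccepts (Some (ls, pre ++ rs)).
Proof.
elim: pre ls => //= v pre IH ls H.
apply: (accepts_next (c := None)) => //=; apply: IH.
by rewrite rev_cons cat_rcons in H.
Qed.

(** * Every reduction is imitated by the search *)

Section Completeness.

(** A reduction by one atom. Only the values of the new entries are prescribed; their words are
    whatever the sweeps output. *)
Lemma accepts_spawn pre p u v post i x' q' r' :
  let e := odd (size pre) in
  slcm e (smul e (pv e (rev u)) x') (s i) (pv e (rev u)) ->
  smul e (s i) q' = smul e (pv e (rev u)) x' ->
  pv e v = smul e (s i) r' ->
  exists p1 u1 v1,
    [/\ pv e p1 = smul e (pv e p) x', pv e (rev u1) = q', pv e v1 = r' &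
        maccepts (Some ([::], pre ++ p1 :: u1 :: v1 :: post)) ->
        maccepts (Some ([::], pre ++ p :: u :: v :: post))].
Proof.
move=> e Hl Hq Hv.
have Hb : sbasic e (tokv (tk0 i)) by rewrite tk0E; apply/sbasic_atom/s_atom.
(* Since [s i] divides entry i + 1, their lcm is that entry, and the token comes out with value 1,
   as [spawn] requires. *)
have [|t [v1 [Ev]]] := @sweep_lcm e (tk0 i) v (pv e v) Hb.
  by rewrite tk0E; apply: slcm_dvd; rewrite Hv; apply: sdvd_mulr.
rewrite -{1}[pv e v](smulx1 e) => /(smulI M_gcd) /esym t1.
have [|t' [u1 [Eu]]] := @sweep_lcm e (tk0 i) (rev u) (smul e (pv e (rev u)) x') Hb.
  by rewrite tk0E; apply: Hl.
move=> /(smulI M_gcd) Hx'.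
exists (p ++ expand e t'), (rev u1), v1; split.
- by rewrite sprod_cat expandE Hx'.
- rewrite revK; apply: (@smulI _ M_gcd e (s i)).
  by rewrite Hq Hx' -(sweep_eq Eu) tk0E.
- by apply: (@smulI _ M_gcd e (s i)); rewrite -Hv -tk0E (sweep_eq Ev) t1 smulx1.
move=> H; rewrite -[pre ++ _]/(pre ++ [:: p; u] ++ v :: post) catA.
apply: accepts_skip; apply: (accepts_next (c := Some i)) => //=.
rewrite map_cat rev_cat /= cats0 size_rev size_map negbK -/e.
move: Ev Eu; rewrite /spawn /msweep => -> /=; rewrite /tk1 t1 eqxx => -> /=.
rewrite rewindE map_rev revK -map_comp.
by rewrite map_id_in => [|w _ /=]; rewrite ?revK // rev_cat !revK; apply: H.
Qed.

(** At position 1 the atom has to divide both entries, so both sweeps must end with the token 1. *)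
Lemma accepts_spawn_first u v post i q' r' :
  pv false u = q' * s i -> pv true v = r' * s i ->
  exists u1 v1,
    [/\ pv false u1 = q', pv true v1 = r' &
        maccepts (Some ([::], u1 :: v1 :: post)) ->
        maccepts (Some ([::], u :: v :: post))].
Proof.
move=> Hu Hv; have Hb : sbasic true (tokv (tk0 i)) by rewrite tk0E; apply/sbasic_atom/s_atom.
have sweep1 w q : pv true w = q * s i ->
    exists t w', [/\ msweep true (tk0 i) w = Some (t, w'), tokv t = 1 & pv true w' = q].
  move=> Hw; have [|t [w' [Ew]]] := @sweep_lcm true (tk0 i) w (pv true w) Hb.
    by rewrite tk0E; apply: slcm_dvd; exists q.
  rewrite -{1}[pv true w](smulx1 true) => /(smulI M_gcd) /esym t1.
  exists t, w'; split=> //; apply: (@smulI _ M_gcd true (s i)).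
  by rewrite -tk0E (sweep_eq Ew) t1 tk0E smulx1 Hw.
have [t [v1 [Ev t1 Hv1]]] := sweep1 _ _ Hv.
have [|t' [u1 [Eu t1' Hu1]]] := sweep1 (rev u) q'; first by rewrite sprod_rev.
exists (rev u1), v1; split=> //; first by rewrite sprod_rev.
move=> H; rewrite -[u :: _]/([:: u] ++ v :: post); apply: accepts_skip.
apply: (accepts_next (c := Some i)) => //=.
by move: Ev Eu; rewrite /spawn /msweep => -> /=; rewrite /tk1 t1 eqxx => -> /=; rewrite t1' eqxx.
Qed.

(** R_{i,xy} is R_{i,x} followed by R_{i,y}, so an induction on a word for x leaves only atoms. For
    the empty word the lcm is the entry itself, and x' = 1. *)
Lemma accepts_reduce pre p u v post x x' q' r' :
  let e := odd (size pre) in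
  slcm e (smul e (pv e (rev u)) x') x (pv e (rev u)) ->
  smul e x q' = smul e (pv e (rev u)) x' ->
  pv e v = smul e x r' ->
  exists p1 u1 v1,
    [/\ pv e p1 = smul e (pv e p) x', pv e (rev u1) = q', pv e v1 = r' &
        maccepts (Some ([::], pre ++ p1 :: u1 :: v1 :: post)) ->
        maccepts (Some ([::], pre ++ p :: u :: v :: post))].
Proof.
move=> e; have [w <-] := atom_words lam_lt s_atoms e x.
elim: w p u v x' => [|i w IH] p u v x' /=.
  move=> [_ _ Hmin]; rewrite !smul1x => -> Hv.
  have : sdvd e (smul e (pv e (rev u)) x') (pv e (rev u)).
    by apply: Hmin; [exists (pv e (rev u)); rewrite smul1x | apply: sdvd_refl].
  move=> [z]; rewrite -smulA -{1}[pv e (rev u)](smulx1 e).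
  move=> /(smulI M_gcd) /esym /(smul_conical M_gcd) [-> _].
  by exists p, u, v; rewrite !smulx1.
rewrite -!smulA => Hl Hq Hv.
have [_ Hum Hmin] := Hl.
have [n Hn] : exists n, slcm e n (s i) (pv e (rev u)).
  by apply: (slcm_exists M_gcd lam_lt _ Hum); rewrite -Hq; apply: sdvd_mulr.
have [[c Hc] [y Hy] Hnmin] := Hn.
have [|||p1 [u1 [v1 [Hp1 Hu1 Hv1 H1]]]] := @accepts_spawn pre p u v post i y c (smul e (pv e w) r').
- by rewrite -/e -Hy.
- by rewrite -/e -Hc.
- by rewrite -/e Hv.
have [z Hz] : sdvd e n (smul e (pv e (rev u)) x').
  by apply: Hnmin; [rewrite -Hq; apply: sdvd_mulr | apply: sdvd_mulr].
have Hx' : x' = smul e y z by apply: (@smulI _ M_gcd e (pv e (rev u))); rewrite Hz Hy smulA.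
have Hwq : smul e (pv e w) q' = smul e c z.
  by apply: (@smulI _ M_gcd e (s i)); rewrite Hq Hz Hc -!smulA.
have [|||p2 [u2 [v2 [Hp2 Hu2 Hv2 H2]]]] := IH p1 u1 v1 z.
(* A common multiple d of w and c becomes, after multiplication by [s i], a common multiple of the
   whole divisor and the original entry, to which the minimality of the given lcm applies. *)
- rewrite Hu1 -Hwq; split; [exact: sdvd_mulr | by rewrite Hwq; apply: sdvd_mulr |].
  move=> d [d1 Hd1] [d2 Hd2].
  have [g] : sdvd e (smul e (pv e (rev u)) x') (smul e (s i) d).
    apply: Hmin; first by exists d1; rewrite Hd1 !smulA.
    by exists (smul e y d2); rewrite Hd2 !smulA -Hc -Hy.
  rewrite -Hq -!smulA => /(smulI M_gcd) ->.
  by exists g; rewrite !smulA.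
- by rewrite Hu1.
- by [].
exists p2, u2, v2; split=> //; first by rewrite Hp2 Hp1 Hx' smulA.
by move=> /H2 /H1.
Qed.

Lemma accepts_reduce_first u v post x q' r' :
  pv false u = q' * x -> pv true v = r' * x ->
  exists u1 v1,
    [/\ pv false u1 = q', pv true v1 = r' &
        maccepts (Some ([::], u1 :: v1 :: post)) ->
        maccepts (Some ([::], u :: v :: post))].
Proof.
have [w <-] := atom_words lam_lt s_atoms true x.
elim: w u v => [|i w IH] u v /=; first by rewrite !mulg1 => <- <-; exists u, v.
rewrite !mulgA => Hu Hv.
have [u1 [v1 [Hu1 Hv1 H1]]] := accepts_spawn_first post Hu Hv.
have [u2 [v2 [Hu2 Hv2 H2]]] := IH _ _ Hu1 Hv1.
by exists u2, v2; split=> // /H2 /H1.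
Qed.

Lemma split_at3 (a b : seq M) n :
  size b = size a -> (n.+2 < size a)%N ->
  (forall j, j != n -> j != n.+1 -> j != n.+2 -> nth 1 b j = nth 1 a j) ->
  exists pre post,
    [/\ size pre = n, a = pre ++ [:: nth 1 a n; nth 1 a n.+1; nth 1 a n.+2] ++ post &
        b = pre ++ [:: nth 1 b n; nth 1 b n.+1; nth 1 b n.+2] ++ post].
Proof.
move=> Hs Hn Hab.
have split3 (c : seq M) : (n.+2 < size c)%N ->
    c = take n c ++ [:: nth 1 c n; nth 1 c n.+1; nth 1 c n.+2] ++ drop n.+3 c.
  move=> Hc; rewrite -{1}(cat_take_drop n c) (drop_nth 1) 1?ltnW 1?ltnW //.
  by rewrite (drop_nth 1) 1?ltnW // (drop_nth 1).
have Hna : (n <= size a)%N by do 3!apply: ltnW.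
exists (take n a), (drop n.+3 a); split; first by rewrite size_takel.
  exact: split3.
rewrite {1}(split3 b) ?Hs //; congr (_ ++ (_ ++ _)).
  apply: (@eq_from_nth _ 1); first by rewrite !size_takel ?Hs.
  move=> j; rewrite size_takel ?Hs // => Hj; rewrite !nth_take //.
  by apply: Hab; rewrite ltn_eqF // ltnW // ltnW.
apply: (@eq_from_nth _ 1); first by rewrite !size_drop Hs.
by move=> j _; rewrite !nth_drop; apply: Hab; rewrite gtn_eqF // !addSn !ltnS ?leqW ?leq_addr.
Qed.

Lemma accepts_R_red a b ws : R_red a b -> entries false ws = a ->
  exists2 ws', entries false ws' = b &
    maccepts (Some ([::], ws')) -> maccepts (Some ([::], ws)).
Proof.
move=> [[|[|i]] [x [_ [Hs /andP [// _ Hi] Hk]]]] /=; rewrite /entry /=.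
  move=> [H1 H2] Ha; subst a; move: Hs Hi Hk H1 H2; case: ws => [|u [|v ws]] //=.
  case: b => [|q [|r b]] //= [Hs] _ Hk H1 H2.
  have [u1 [v1 [Hu1 Hv1 H]]] := accepts_reduce_first ws (esym H1) (esym H2).
  exists [:: u1, v1 & ws] => //=; rewrite Hu1 Hv1; congr [:: _, _ & _].
  apply: (@eq_from_nth _ 1) => // j _.
  (* Entries are numbered from 1, so index j after the first two entries is entry j + 3. *)
  by apply/esym; apply: (Hk j.+3).
move=> Hcond Ha.
have [|pre [post [Hpre Ea Eb]]] := @split_at3 a b i Hs Hi.
  by move=> j *; apply: (Hk j.+1).
move: (nth 1 a i) (nth 1 a i.+1) (nth 1 a i.+2) (nth 1 b i) (nth 1 b i.+1) (nth 1 b i.+2) Ea Eb Hcond.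
move=> p q r p' q' r' Ea Eb Hcond.
have [x' [Hp Hq Hl Hr]] : let e := odd i in exists x',
    [/\ p' = smul e p x', smul e x q' = smul e q x', slcm e (smul e q x') x q &
        smul e x r' = r].
  by move: Hcond; rewrite /= negbK; case: (odd i) => -[x' [? ? ? ?]]; exists x'; split.
have [ws1 [ws2 [Ews Hws1]]] := entries_inv (etrans Ha Ea).
rewrite Hpre addbF; case: ws2 Ews => [//|w1 [//|u [//|v ws2]]] Ews /= [Hw1 Hu Hv Hws2].
have Hsz : size ws1 = i by rewrite -(size_entries false) Hws1.
have [|||p1 [u1 [v1 [Hp1 Hu1 Hv1 H]]]] := @accepts_reduce ws1 w1 u v ws2 x x' q' r'.
- by rewrite Hsz sprod_rev Hu.
- by rewrite Hsz sprod_rev Hu.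
- by rewrite Hsz negbK in Hv *; rewrite Hv Hr.
exists (ws1 ++ [:: p1, u1, v1 & ws2]); last by rewrite Ews.
rewrite entries_cat Hws1 Eb Hsz addbF /=; rewrite Hsz in Hp1 Hu1 Hv1.
by rewrite Hws2 Hp1 Hw1 Hp -sprod_rev Hu1 negbK Hv1.
Qed.

Lemma accepts_complete n ws :
  R_reds (entries false ws) (ones M n) -> maccepts (Some ([::], ws)).
Proof.
move=> /clos_rt_rt1n_iff.
move Ea: (entries _ _) => a; move Eb: (ones _ _) => b H.
elim: H ws Ea Eb => [{}a | {}a c {}b Hac _ IH] ws Ea Eb.
  rewrite -[ws]cats0; apply: accepts_skip; apply: accepts_leaf => /=.
  congr Some; rewrite cats0 all_rev all_map.
  have : entries false ws = nseq (size ws) 1.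
    move: Ea; rewrite -Eb => E; rewrite E; congr nseq.
    by rewrite -(size_entries false) E size_nseq.
  elim: ws (false) {Ea Eb a} => //= w ws IH e [/(sprod_eq1 M_gcd s_atoms) -> /IH].
  by rewrite /nilp.
by have [ws' Hws' H] := accepts_R_red Hac Ea; apply/H/IH.
Qed.

End Completeness.

(** * Invariance of the value in the group *)

Section Soundness.

Variables (U : groupType) (iota : M -> U).
Hypothesis iota_morph : monoid_morphism iota.

Definition signed e (x : M) : U := if e then (iota x)^-1 else iota x.

Lemma signed1 e : signed e 1 = 1.
Proof. by rewrite /signed iota_morph.1 invg1 if_same. Qed.

(** Inversion reverses products, and the opposite multiplication reverses them back. *)
Lemma signedM e x y : signed e (smul e x y) = signed e x * signed e y.
Proof. by case: e; rewrite /= iota_morph.2 // invgM. Qed.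

Lemma signedN e x : signed (~~ e) x = (signed e x)^-1.
Proof. by case: e; rewrite /= ?invgK. Qed.

(** The word next to the position is read on side e, but its entry carries the other exponent,
    whence the inverse. *)
Fixpoint left_value e ls : U :=
  if ls is u :: ls' then left_value (~~ e) ls' * (signed e (pv e u))^-1 else 1.

Definition state_value ls rs : U :=
  let e := odd (size ls) in left_value e ls * alternating_product iota e (entries e rs).

Lemma alternating_cons e w ws : alternating_product iota e (entries e (w :: ws)) =
  signed e (pv e w) * alternating_product iota (~~ e) (entries (~~ e) ws).
Proof. by []. Qed.

Lemma state_value_skip ls v rs : state_value (rev v :: ls) rs = state_value ls (v :: rs).
Proof.
rewrite /state_value alternating_cons /=; set e := odd _.
by rewrite negbK sprod_revN signedN invgK mulgA.
Qed.

Lemma state_value_rewind ls rs : state_value [::] (rewind ls rs) = state_value ls rs.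
Proof. by elim: ls rs => //= u ls IH rs; rewrite IH -state_value_skip revK. Qed.

Lemma spawn_size i ls rs ls' rs' :
  mspawn (odd (size ls)) i ls rs = Some (ls', rs') -> size ls' = size ls.
Proof.
rewrite /mspawn /spawn; case: ls => // u ls; case: rs => // v rs.
case: (sweep tok _ (tk0 i) v) => [[t v']|//]; case: ifP => // _.
case: (sweep tok _ (tk0 i) u) => [[t' u']|//]; case: ls => [|u2 ls]; last by move=> [<- _].
by case: ifP => // _ [<- _].
Qed.

Lemma spawn_value i ls rs ls' rs' :
  mspawn (odd (size ls)) i ls rs = Some (ls', rs') ->
  state_value ls' rs' = state_value ls rs.
Proof.
move=> E; rewrite /state_value (spawn_size E); move: E.
set e := odd _; rewrite /mspawn /spawn; case: ls @e => // u ls e; case: rs => // v rs.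
case Ev: (sweep tok e (tk0 i) v) => [[t v']|//]; case: ifP => // /eqP t1.
case Eu: (sweep tok e (tk0 i) u) => [[t' u']|//].
have := sweep_eq Ev; rewrite t1 smulx1 => Hv; have := sweep_eq Eu => Hu.
(* With x = [s i], the equalities x v' = v and x u' = u t' give u^-1 v = t' u'^-1 v'; the factor t'
   goes into entry i - 1. *)
have Hcut g : g * (signed e (pv e u))^-1 * signed e (pv e v) =
    g * signed e (tokv t') * (signed e (pv e u'))^-1 * signed e (pv e v').
  rewrite -Hv signedM mulgA; congr (_ * _); rewrite -!mulgA; congr (_ * _).
  have := congr1 (signed e) Hu; rewrite !signedM => Hu'.
  apply: (@mulgI _ (signed e (pv e u))); rewrite mulVKg.
  by rewrite mulgA -Hu' mulgK.
rewrite !alternating_cons !mulgA; case: ls @e => [|u2 ls] e in Ev Eu Hv Hu Hcut *.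
  case: ifP => // /eqP t1' [<- <-]; rewrite alternating_cons mulgA Hcut.
  by rewrite t1' signed1 mulg1.
clearbody e; move=> [<- <-]; rewrite alternating_cons mulgA Hcut /= negbK.
rewrite sprod_cat sprod_rev negbK expandE signedM !signedN.
by rewrite invgM !invgK !mulgA.
Qed.

Lemma accepts_value x : maccepts x -> if x is Some (ls, rs) then state_value ls rs = 1 else False.
Proof.
elim=> {x} [[[ls [|v rs]]|] //= [Hnil] | [[ls [|v rs]]|] //= [i|] _ _].
- rewrite /state_value /= mulg1.
  elim: ls (odd _) Hnil => //= u ls IH e /andP [/nilP -> /IH ->].
  by rewrite /= signed1 invg1 mulg1.
- case E: spawn => [[ls' rs']|//].
  by rewrite state_value_rewind => <-; rewrite -(spawn_value E).
- by rewrite state_value_skip.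
Qed.

Lemma accepts_sound ws : maccepts (Some ([::], ws)) -> mf_value iota (entries false ws) = 1.
Proof. by move/accepts_value; rewrite /state_value /= mul1g. Qed.

End Soundness.

(** * Finiteness of the search tree *)

Section Termination.

(* The entries are compared from right to left: a reduction at position i makes entry i + 1 smaller. *)
Inductive lexlt : seq nat -> seq nat -> Prop :=
| lexlt_head x y a b : (x < y)%N -> size a = size b -> lexlt (x :: a) (y :: b)
| lexlt_tail x a b : lexlt a b -> lexlt (x :: a) (x :: b).

Lemma lexlt_size a b : lexlt a b -> size a = size b.
Proof. by elim=> [x y {}a {}b _ /= -> | x {}a {}b _ /= ->]. Qed.

Lemma lexlt_wf a : Acc lexlt a.
Proof.
have [n] := ubnP (size a); elim: n a => [[|//]|n IH [|x a] Hn]; first by [].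
  by constructor=> b H; inversion H.
have [m] := ubnP x; elim: m x a Hn => [//|m IHm] x a Hn /ltnSE Hx.
have Ha := IH a Hn; elim: Ha Hn => {}a _ IHa Hn; constructor=> b H.
inversion H as [y z c d Hyz Hcd E1 E2 | y c d Hcd E1 E2]; subst.
  by apply: IHm; [rewrite /= Hcd | apply: leq_trans Hx].
by apply: (IHa _ Hcd); rewrite /= (lexlt_size Hcd).
Qed.

(** Rewinding first makes the weights independent of the position, hence unchanged by a move to the
    right. *)
Definition weights ls rs : seq nat := rev (map lam (entries false (rewind ls rs))).

Lemma entries_rewind ls rs : entries false (rewind ls rs) =
  entries false (rewind ls [::]) ++ entries (odd (size ls)) rs.
Proof.
by rewrite !rewindE cats0 entries_cat size_rev size_map addbF.
Qed.

Lemma spawn_weights i ls rs ls' rs' :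
  mspawn (odd (size ls)) i ls rs = Some (ls', rs') -> lexlt (weights ls' rs') (weights ls rs).
Proof.
move=> E; have Hs := spawn_size E.
rewrite /weights entries_rewind (entries_rewind ls) Hs !map_cat !rev_cat.
have Hs' : size (rev (map lam (entries false (rewind ls' [::])))) =
    size (rev (map lam (entries false (rewind ls [::])))).
  by rewrite !size_rev !size_map !size_entries !rewindE !size_cat !size_rev !size_map Hs.
move: E Hs'; set e := odd _; move: (rev _) (rev (map _ (entries _ (rewind ls _)))) => a b.
rewrite /mspawn /spawn; case: ls {Hs} @e => // u ls e; case: rs => // v rs.
case Ev: (sweep tok e (tk0 i) v) => [[t v']|//]; case: ifP => // /eqP t1 E.
have -> : rs' = v' :: rs.
  move: E; case: (sweep tok e (tk0 i) u) => [[t' u']|//].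
  by case: ls @e {Ev} => [|u2 ls] e; [case: ifP => // _ | ]; move=> [_ ->].
have := sweep_eq Ev; rewrite t1 smulx1 tk0E => Hv Hab.
rewrite /= !rev_cons !cat_rcons -Hv.
(* The entries after i + 1 are compared first and are unchanged. *)
elim: (rev _) => [|y c IH] /=; last exact: lexlt_tail.
by apply: lexlt_head => //; apply/lam_lt/(s_atom s_atoms i).1.
Qed.

(** A reduction lowers the weights; a move to the right keeps them and shortens the list on the
    right. *)
Lemma child_wf x : Acc mchild x.
Proof.
have Hnone : Acc mchild None by constructor=> y [].
case: x => [[ls rs]|]; last exact: Hnone.
move Ew: (weights ls rs) => w; elim: (lexlt_wf w) ls rs Ew => {}w _ IH ls rs Ew.
elim: rs ls Ew => [|v rs IHrs] ls Ew; first by constructor=> y [].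
constructor=> y [_ [[i|] ->]] /=; last first.
  by apply: IHrs; rewrite -Ew /weights /= revK.
case E: spawn => [[ls' rs']|]; last exact: Hnone.
by apply: (IH _ _ [::] _ erefl); rewrite -Ew; apply: (spawn_weights E).
Qed.

End Termination.

End SearchCorrectness.

(** * Composing Turing machines *)

Section Fragments.

Variables (J S : finType).

(* Tapes as functions: the cells left of the head, nearest first, and the cells from the head rightwards.
   Unlike for pairs of lists, equality of tapes does not depend on trailing blanks. *)
Definition ftape : Type := (nat -> option S) * (nat -> option S).
Definition action : Type := option S * tm_move.

Definition scons (c : option S) (r : nat -> option S) : nat -> option S :=
  fun n => if n is n'.+1 then r n' else c.
Definition stail (r : nat -> option S) : nat -> option S := fun n => r n.+1.

Definition ftape_act (t : ftape) (a : action) : ftape :=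
  match a.2 with
  | MoveLeft => (stail t.1, scons (t.1 0) (scons a.1 (stail t.2)))
  | Stay => (t.1, scons a.1 (stail t.2))
  | MoveRight => (scons a.1 t.1, stail t.2)
  end.

Definition scan (ts : J -> ftape) : J -> option S := fun j => (ts j).2 0.
Definition act (ts : J -> ftape) (a : J -> action) : J -> ftape :=
  fun j => ftape_act (ts j) (a j).
Definition idle (rd : J -> option S) : J -> action := fun j => (rd j, Stay).

Lemma scons_stail r : scons (r 0) (stail r) = r.
Proof. by apply: functional_extensionality; case. Qed.

Lemma ftape_act_stay t : ftape_act t (t.2 0, Stay) = t.
Proof. by case: t => l r; rewrite /ftape_act /= scons_stail. Qed.

Lemma act_idle ts : act ts (idle (scan ts)) = ts.
Proof. by apply: functional_extensionality => j; apply: ftape_act_stay. Qed.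

(* A state is either final, with a result in F, or has a transition; programs then compose as a monad. *)
Record frag (F : Type) := Frag {
  fstate : finType;
  fstart : fstate;
  fcode : fstate -> F + ((J -> option S) -> fstate * (J -> action))
}.

Inductive runs (F : Type) (Q : finType)
    (code : Q -> F + ((J -> option S) -> Q * (J -> action))) :
    Q -> (J -> ftape) -> F -> (J -> ftape) -> Prop :=
| runs_final q ts f : code q = inl f -> runs code q ts f ts
| runs_step q g ts f ts' : code q = inr g ->
    runs code (g (scan ts)).1 (act ts (g (scan ts)).2) f ts' -> runs code q ts f ts'.

Definition ev (F : Type) (m : frag F) ts f ts' := runs (@fcode F m) (fstart m) ts f ts'.

Definition ret (F : Type) (f : F) : frag F :=
  @Frag F unit tt (fun _ => inl f).

Lemma ev_ret (F : Type) (f : F) ts : ev (ret f) ts f ts.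
Proof. exact: runs_final. Qed.

Section Bind.

Variables (F : finType) (G : Type) (m : frag F) (h : F -> frag G).

(** The intermediate result f becomes part of the state, which is why F is a finite type; control
    passes to h f by an idle step. *)
Definition bind_code (q : fstate m + {f : F & fstate (h f)}) :
    G + ((J -> option S) -> (fstate m + {f : F & fstate (h f)}) * (J -> action)) :=
  match q with
  | inl q => match fcode q with
    | inl f => inr (fun rd => (inr (existT _ f (fstart (h f))), idle rd))
    | inr g => inr (fun rd => (inl (g rd).1, (g rd).2))
    end
  | inr (existT f q) => match fcode q with
    | inl b => inl b
    | inr g => inr (fun rd => (inr (existT _ f (g rd).1), (g rd).2))
    end
  end.

Definition bind : frag G := Frag (inl (fstart m)) bind_code.

Lemma ev_bind ts f ts1 b ts2 : ev m ts f ts1 -> ev (h f) ts1 b ts2 -> ev bind ts b ts2.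
Proof.
rewrite /ev => Hm Hh.
have H : runs bind_code (inr (existT _ f (fstart (h f)))) ts1 b ts2.
  elim: Hh => [q ts' b' E | q g ts' b' ts'' E _ IH].
    by apply: runs_final; rewrite /= E.
  apply: runs_step; first by rewrite /= E.
  exact: IH.
move: H {Hh}; rewrite /=.
elim: Hm => [q ts' f' E | q g ts' f' ts'' E _ IH] H.
  apply: runs_step; first by rewrite /= E.
  by rewrite /= act_idle.
apply: runs_step; first by rewrite /= E.
exact: (IH H).
Qed.

End Bind.

Section Iter.

Variables (A : finType) (B : Type) (body : A -> frag (A + B)).

Definition iter_code (q : {a : A & fstate (body a)}) :
    B + ((J -> option S) -> {a : A & fstate (body a)} * (J -> action)) :=
  let: existT a q := q in
  match fcode q with
  | inl (inl a') => inr (fun rd => (existT _ a' (fstart (body a')), idle rd))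
  | inl (inr b) => inl b
  | inr g => inr (fun rd => (existT _ a (g rd).1, (g rd).2))
  end.

Definition loop (a : A) : frag B := Frag (existT _ a (fstart (body a))) iter_code.

Lemma ev_loop_done a ts b ts' : ev (body a) ts (inr b) ts' -> ev (loop a) ts b ts'.
Proof.
rewrite /ev /=; move E: (inr b) => r H.
elim: H E => [q ts1 r1 Eq | q g ts1 r1 ts2 Eq _ IH] E.
  by apply: runs_final; rewrite /= Eq -E.
apply: runs_step; first by rewrite /= Eq.
exact: (IH E).
Qed.

Lemma ev_loop_next a ts a' ts' b ts'' :
  ev (body a) ts (inl a') ts' -> ev (loop a') ts' b ts'' -> ev (loop a) ts b ts''.
Proof.
rewrite /ev /=; move E: (inl a') => r H.
elim: H E => [q ts1 r1 Eq | q g ts1 r1 ts2 Eq _ IH] E Hl.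
  apply: runs_step; first by rewrite /= Eq -E.
  by rewrite /= act_idle.
apply: runs_step; first by rewrite /= Eq.
exact: (IH E).
Qed.

End Iter.

Definition on_tape (j0 : J) (rd : J -> option S) (a : action) : J -> action :=
  fun j => if j == j0 then a else (rd j, Stay).

Definition upd (T : Type) (g : J -> T) (j0 : J) (x : T) : J -> T :=
  fun j => if j == j0 then x else g j.

Lemma act_on_tape ts j a :
  act ts (on_tape j (scan ts) a) = upd ts j (ftape_act (ts j) a).
Proof.
apply: functional_extensionality => j'; rewrite /act /on_tape /upd.
by case: eqP => [->//|_]; apply: ftape_act_stay.
Qed.

Section OneStep.

Variables (F : finType) (j : J) (g : option S -> F * action).

Definition one_step : frag F := @Frag F (option F) None
  (fun q => if q is Some f then inl f
            else inr (fun rd => (Some (g (rd j)).1, on_tape j rd (g (rd j)).2))).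

Lemma ev_one_step ts :
  ev one_step ts (g ((ts j).2 0)).1 (upd ts j (ftape_act (ts j) (g ((ts j).2 0)).2)).
Proof.
apply: runs_step; first by [].
by rewrite /= act_on_tape; apply: runs_final.
Qed.

End OneStep.

(* A stack is kept at the head of a tape: its top is scanned, and a blank follows its last element. *)
Fixpoint holds (s : seq S) (r : nat -> option S) : Prop :=
  if s is c :: s' then r 0 = Some c /\ holds s' (stail r) else r 0 = None.

(** Cells beyond the closing blank are unconstrained, so on an empty stack the head must not
    move. *)
Definition pop (j : J) : frag (option S) :=
  one_step j (fun c => (c, (None, if c is Some _ then MoveRight else Stay))).

Definition push (j : J) (c : S) : frag unit :=
  bind (one_step j (fun c' => (tt, (c', MoveLeft))))
       (fun _ : unit => one_step j (fun _ => (tt, (Some c, Stay)))).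

Lemma upd_upd (T : Type) (g : J -> T) j x y : upd (upd g j x) j y = upd g j y.
Proof. by apply: functional_extensionality => j'; rewrite /upd; case: eqP. Qed.

Lemma upd_eq (T : Type) (g : J -> T) j x : upd g j x j = x.
Proof. by rewrite /upd eqxx. Qed.

Lemma ev_push j c ts :
  ev (push j c) ts tt (upd ts j (stail (ts j).1, scons (Some c) (ts j).2)).
Proof.
have := ev_one_step j (fun c' => (tt, (c', MoveLeft))) ts => H1.
apply: (ev_bind H1).
have := ev_one_step j (fun _ => (tt, (Some c, Stay))) (upd ts j
  (ftape_act (ts j) ((ts j).2 0, MoveLeft))).
rewrite upd_upd upd_eq /ftape_act /= => H; move: H.
suff -> : stail (scons ((ts j).1 0) (scons ((ts j).2 0) (stail (ts j).2))) = (ts j).2 by [].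
by apply: functional_extensionality; case.
Qed.

Lemma ev_pop j ts : exists t',
  ev (pop j) ts ((ts j).2 0) (upd ts j t') /\
  forall s, holds s (ts j).2 -> (ts j).2 0 = ohead s /\ holds (behead s) t'.2.
Proof.
have H := ev_one_step j (fun c => (c, (None, if c is Some _ then MoveRight else Stay))) ts.
eexists; split; first exact: H.
case=> [|c s] /=; first by move=> ->.
by move=> [-> Hs].
Qed.

End Fragments.

Lemma until_blank_holds (A B : finType) (T : turing_machine A B)
    (s : seq (tm_symbol T)) (r : seq (option (tm_symbol T))) :
  holds s (nth None r) -> until_blank r = s.
Proof.
elim: s r => [|c s IH] [|[x|] r] //=; try by case.
by move=> [[->] Hs]; rewrite (IH r).
Qed.

(** * From fragments to Turing machines *)

Section Realization.

Variables (A B J S : finType) (tin : A -> S) (tout : B -> S).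
Hypotheses (tin_inj : injective tin) (tout_inj : injective tout).
Variables (m : frag J S unit) (j0 : J).

Definition ftape_of (l r : seq (option S)) : ftape S := (nth None l, nth None r).

Lemma ftape_of_act (t : seq (option S) * seq (option S)) (a : action S) :
  let t' := match a.2 with
    | MoveLeft => (behead t.1, head None t.1 :: a.1 :: behead t.2)
    | Stay => (t.1, a.1 :: behead t.2)
    | MoveRight => (a.1 :: t.1, behead t.2)
    end in
  ftape_of t'.1 t'.2 = ftape_act (ftape_of t.1 t.2) a.
Proof.
case: t => l r; case: a => c mv; rewrite /ftape_act /ftape_of /=.
have Hb (u : seq (option S)) : nth None (behead u) = stail (nth None u).
  by apply: functional_extensionality => n; rewrite nth_behead.
have Hc x (u : seq (option S)) : nth None (x :: u) = scons x (nth None u).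
  by apply: functional_extensionality; case.
by case: mv; rewrite /= ?Hc ?Hb ?nth0.
Qed.

(** Input and output are on tape 0, so any numbering of the tapes is corrected by a transposition
    that puts j0 there. *)
Lemma ord_enumeration : exists (n : nat) (g : 'I_n.+1 -> J) (h : J -> 'I_n.+1),
  [/\ cancel g h, cancel h g & g ord0 = j0].
Proof.
have Hn : #|J| = #|J|.-1.+1 by rewrite prednK //; apply/card_gt0P; exists j0.
pose h0 j := cast_ord Hn (enum_rank j); pose g0 i := enum_val (cast_ord (esym Hn) i).
have Hg0 : cancel g0 h0 by move=> i; rewrite /h0 enum_valK cast_ordKV.
have Hh0 : cancel h0 g0 by move=> j; rewrite /g0 cast_ordK enum_rankK.
pose sw i := if i == ord0 then h0 j0 else if i == h0 j0 then ord0 else i.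
have Hsw : cancel sw sw.
  move=> i; rewrite /sw; case: (altP (i =P ord0)) => [->|Hi].
    by rewrite eqxx; case: eqP.
  by case: (altP (i =P h0 j0)) => [->|/negPf ->]; rewrite ?eqxx // (negPf Hi).
exists (#|J|.-1), (g0 \o sw), (sw \o h0); split.
- by move=> i; rewrite /= Hg0 Hsw.
- by move=> j; rewrite /= Hsw Hh0.
- by rewrite /= /sw eqxx Hh0.
Qed.

Definition initial_tapes (w : seq A) : J -> ftape S :=
  fun j => ftape_of [::] (if j == j0 then [seq Some (tin x) | x <- w] else [::]).

Lemma realization : exists T : turing_machine A B, forall w v ts,
  ev m (initial_tapes w) tt ts -> holds (map tout v) (ts j0).2 -> tm_computes T w v.
Proof.
have [n [g [h [Hgh Hhg Hg0]]]] := ord_enumeration.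
pose final (q : fstate m) := if fcode q is inl _ then true else false.
pose tr (q : fstate m) (rd : {ffun 'I_n.+1 -> option S}) :
    fstate m * {ffun 'I_n.+1 -> option S * tm_move} :=
  if fcode q is inr c then
    let r := c (fun j => rd (h j)) in (r.1, [ffun i => r.2 (g i)])
  else (q, [ffun=> (None, Stay)]).
pose T := @TuringMachine A B n (fstate m) S tin tout tin_inj tout_inj (fstart m) final tr.
exists T => w v ts H Hv.
(* [abs] forgets trailing blanks; up to it, one step of the fragment is one step of T. *)
pose abs (c : {ffun 'I_n.+1 -> tape T}) : J -> ftape S := fun j => ftape_of (c (h j)).1 (c (h j)).2.
have Hinit : abs (tm_init T w).2 = initial_tapes w.
  apply: functional_extensionality => j; rewrite /abs /initial_tapes ffunE /=.
  by rewrite -(inj_eq (can_inj Hgh)) Hhg Hg0.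
suff Hrun : exists t, let c := iter t (@tm_step A B T) (tm_init T w) in
    tm_final c.1 /\ abs c.2 = ts.
  have [t [Hf Ht]] := Hrun; exists t; split=> //.
  rewrite /tm_output; apply: (@until_blank_holds A B T).
  by move: Hv; rewrite -Ht /abs -Hg0 Hgh => Hv; exact: Hv.
move: H; rewrite /ev -Hinit (_ : fstart m = (tm_init T w).1) //.
move Ets: (abs _) => ts0; move: (tm_init T w) Ets => c0 Ets.
have [q Eq] : exists q, q = c0.1 by eexists.
move=> H; rewrite -Eq in H; move: H; move E: tt => u H.
elim: H c0 Ets Eq {E} => {q ts0 ts Hv} [q ts f Ef | q k ts0 f ts Ek _ IH] c0 Ets Eq.
  by exists 0; rewrite /= -Eq /final Ef.
have [||t Ht] := IH (tm_step c0); last by exists t.+1; rewrite iterSr.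
  case: c0 Ets Eq => q0 tp /= Ets Eq; subst q0; rewrite /final Ek /tr Ek /= -Ets.
  apply: functional_extensionality => j; rewrite /abs /act ffunE ffunE Hhg.
  set a := ((k _).2 j); set b := ((k _).2 j).
  have -> : b = a.
    congr ((k _).2 j); apply: functional_extensionality => j'.
    by rewrite /scan ffunE /tape_read /= nth0.
  rewrite -ftape_of_act /tape_act; case: (tp (h j)) => l r; case: a => c mv /=.
  by case: mv.
case: c0 Ets Eq => q0 tp /= Ets Eq; subst q0; rewrite /final Ek /tr Ek /= -Ets.
congr (k _).1; apply: functional_extensionality => j'.
by rewrite /scan ffunE /tape_read /= nth0.
Qed.

End Realization.

(** * Specifications of stack programs *)

Section StackPrograms.

(* The tapes in N are used as stacks, those in X are not. *)
Variables (N X S : finType).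
Local Notation J := (N + X)%type.
Implicit Types (j : N) (x : X) (g : N -> seq S) (h : X -> ftape S) (c : S).

(** A stack leaves the cells left of the head and past its closing blank open. The other tapes are
    known exactly, because they serve a foreign machine that may move anywhere. *)
Definition sees g h (ts : J -> ftape S) : Prop :=
  (forall j, holds (g j) (ts (inl j)).2) /\ (forall x, ts (inr x) = h x).

Definition evs (F : Type) (m : frag J S F) g h (f : F) g' h' : Prop :=
  forall ts, sees g h ts -> exists2 ts', ev m ts f ts' & sees g' h' ts'.

Lemma evs_eq (F : Type) (m : frag J S F) g h f g1 h1 g2 :
  evs m g h f g1 h1 -> (forall j, g1 j = g2 j) -> evs m g h f g2 h1.
Proof.
move=> H E ts /H [ts' Hm [Hg Hh]]; exists ts' => //; split=> // j.
by rewrite -E.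
Qed.

Lemma evs_ret (F : Type) (f : F) g h : evs (ret J S f) g h f g h.
Proof. by move=> ts Hts; exists ts => //; apply: ev_ret. Qed.

Lemma evs_bind (F : finType) (G : Type) (m : frag J S F) (k : F -> frag J S G)
    g h f g1 h1 b g2 h2 :
  evs m g h f g1 h1 -> evs (k f) g1 h1 b g2 h2 -> evs (bind m k) g h b g2 h2.
Proof.
move=> H1 H2 ts /H1 [ts1 E1 /H2 [ts2 E2 H]].
by exists ts2 => //; apply: ev_bind E1 E2.
Qed.

Lemma evs_loop_done (A : finType) (B : Type) (body : A -> frag J S (A + B)) a g h b g1 h1 :
  evs (body a) g h (inr b) g1 h1 -> evs (loop body a) g h b g1 h1.
Proof. by move=> H ts /H [ts1 E ?]; exists ts1 => //; apply: ev_loop_done. Qed.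

Lemma evs_loop_next (A : finType) (B : Type) (body : A -> frag J S (A + B))
    a g h a' g1 h1 b g2 h2 :
  evs (body a) g h (inl a') g1 h1 -> evs (loop body a') g1 h1 b g2 h2 ->
  evs (loop body a) g h b g2 h2.
Proof.
move=> H1 H2 ts /H1 [ts1 E1 /H2 [ts2 E2 H]].
by exists ts2 => //; apply: ev_loop_next E1 E2.
Qed.

Lemma evs_push j c g h : evs (push (inl j) c) g h tt (upd g j (c :: g j)) h.
Proof.
move=> ts [Hg Hh]; eexists; first exact: ev_push.
split=> [j'|x]; last by rewrite /upd; case: eqP.
rewrite /upd; have -> : (inl j' == inl j :> J) = (j' == j) by [].
by case: eqP => // ->.
Qed.

Lemma evs_pop j g h :
  evs (pop S (inl j)) g h (ohead (g j)) (upd g j (behead (g j))) h.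
Proof.
move=> ts [Hg Hh]; have [t' [E Ht']] := ev_pop (inl j) ts.
have [Eh Hb] := Ht' _ (Hg j); rewrite -Eh; eexists; first exact: E.
split=> [j'|x]; last by rewrite /upd; case: eqP.
rewrite /upd; have -> : (inl j' == inl j :> J) = (j' == j) by [].
by case: eqP.
Qed.

Lemma evs_push_raw x c g h :
  evs (push (inr x) c) g h tt g (upd h x (stail (h x).1, scons (Some c) (h x).2)).
Proof.
move=> ts [Hg Hh]; eexists; first exact: ev_push.
split=> [j|x']; first by rewrite /upd; case: eqP.
rewrite /upd; have -> : (inr x' == inr x :> J) = (x' == x) by [].
by case: eqP; rewrite Hh.
Qed.

Lemma evs_pop_raw x g h s : holds s (h x).2 ->
  exists2 h', evs (pop S (inr x)) g h (ohead s) g h' & holds (behead s) (h' x).2.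
Proof.
move=> Hs; pose t' := ftape_act (h x) (None, if (h x).2 0 is Some _ then MoveRight else Stay).
exists (upd h x t') => [ts [Hg Hh]|]; last first.
  by rewrite upd_eq /t'; case: s Hs => [|c s] /=; [move=> -> | move=> [-> ?]].
have := ev_one_step (inr x) (fun o => (o, (None, if o is Some _ then MoveRight else Stay))) ts.
rewrite /= Hh; have -> : (h x).2 0 = ohead s by case: s Hs => [|c s] //= [].
move=> E; eexists; first exact: E.
split=> [j|x']; first by rewrite /upd; case: eqP.
rewrite /upd; have -> : (inr x' == inr x :> J) = (x' == x) by [].
rewrite /t'; have -> : (h x).2 0 = ohead s by case: s Hs {E t'} => [|c s] //= [].
by case: eqP => [_|_]; rewrite ?Hh.
Qed.

Ltac solve_store := let j := fresh in
  move=> j; rewrite /upd; repeat (case: eqP => ?; subst => //); try congruence.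

Definition is_empty j : frag J S bool :=
  bind (pop S (inl j)) (fun o =>
    if o is Some c then bind (push (inl j) c) (fun _ => ret J S false)
    else ret J S true).

Lemma evs_is_empty j g h : evs (is_empty j) g h (nilp (g j)) g h.
Proof.
apply: evs_bind; first exact: evs_pop.
case E: (g j) => [|c s] /=.
  by apply: evs_eq; [exact: evs_ret | solve_store].
apply: evs_bind; first exact: evs_push.
by apply: evs_eq; [exact: evs_ret | solve_store].
Qed.

Definition move_all j1 j2 : frag J S unit :=
  loop (fun _ : unit => bind (pop S (inl j1)) (fun o =>
    if o is Some c then bind (push (inl j2) c) (fun _ => ret J S (inl tt))
    else ret J S (inr tt))) tt.

Lemma evs_move_all j1 j2 g h : j1 != j2 ->
  evs (move_all j1 j2) g h tt (upd (upd g j1 [::]) j2 (rev (g j1) ++ g j2)) h.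
Proof.
move=> /eqP Hj; rewrite -catrevE; move E: (g j1) => s; elim: s g E => [|c s IH] g E.
  apply: evs_loop_done; apply: evs_bind; first exact: evs_pop.
  by rewrite E; apply: evs_eq; [exact: evs_ret | solve_store].
apply: evs_loop_next.
  apply: evs_bind; first exact: evs_pop.
  rewrite E; apply: evs_bind; first exact: evs_push.
  exact: evs_ret.
apply: evs_eq; first by apply: IH; rewrite /upd; case: eqP => //; rewrite eqxx.
by solve_store.
Qed.

Definition clear j : frag J S unit :=
  loop (fun _ : unit => bind (pop S (inl j)) (fun o =>
    ret J S (if o is Some _ then inl tt else inr tt))) tt.

Lemma evs_clear j g h : evs (clear j) g h tt (upd g j [::]) h.
Proof.
move E: (g j) => s; elim: s g E => [|c s IH] g E.
  apply: evs_loop_done; apply: evs_bind; first exact: evs_pop.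
  by rewrite E; apply: evs_eq; [exact: evs_ret | solve_store].
apply: evs_loop_next.
  by apply: evs_bind; [exact: evs_pop | rewrite E; exact: evs_ret].
by apply: evs_eq; [apply: IH; rewrite upd_eq | solve_store].
Qed.

Definition copy_all j1 j2 j3 : frag J S unit :=
  loop (fun _ : unit => bind (pop S (inl j1)) (fun o =>
    if o is Some c then
      bind (push (inl j2) c) (fun _ => bind (push (inl j3) c) (fun _ => ret J S (inl tt)))
    else ret J S (inr tt))) tt.

Lemma evs_copy_all j1 j2 j3 g h : j1 != j2 -> j1 != j3 -> j2 != j3 ->
  evs (copy_all j1 j2 j3) g h tt
    (upd (upd (upd g j1 [::]) j2 (rev (g j1) ++ g j2)) j3 (rev (g j1) ++ g j3)) h.
Proof.
move=> /eqP H12 /eqP H13 /eqP H23; rewrite -!catrevE.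
move E: (g j1) => s; elim: s g E => [|c s IH] g E.
  apply: evs_loop_done; apply: evs_bind; first exact: evs_pop.
  by rewrite E; apply: evs_eq; [exact: evs_ret | solve_store].
apply: evs_loop_next.
  apply: evs_bind; first exact: evs_pop.
  rewrite E; apply: evs_bind; first exact: evs_push.
  apply: evs_bind; first exact: evs_push.
  exact: evs_ret.
apply: evs_eq; first by apply: IH; rewrite /upd; do !case: eqP => //; rewrite eqxx.
by solve_store.
Qed.

Definition pushes j (s : seq S) : frag J S unit :=
  foldr (fun c m => bind (push (inl j) c) (fun _ => m)) (ret J S tt) s.

Lemma evs_pushes j s g h : evs (pushes j s) g h tt (upd g j (rev s ++ g j)) h.
Proof.
rewrite -catrevE; elim: s g => [|c s IH] g /=.
  by apply: evs_eq; [exact: evs_ret | solve_store].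
apply: evs_bind; first exact: evs_push.
by apply: evs_eq; [exact: IH | rewrite upd_eq upd_upd].
Qed.

End StackPrograms.

(** * The decision machine *)

(** With triples of booleans, a statement about all tapes is checked by computation in eight
    cases. *)
Definition own_tape : Type := bool * bool * bool.

(* [word_tape] keeps the multifraction from which each trial starts; [left_tape] and [right_tape] hold the
   entries on both sides of the current position, and [temp_tape] the result of a sweep; [past_tape] and
   [future_tape] hold the choices already made and the recorded choices still to be followed. *)
Definition in_tape : own_tape := (false, false, false).
Definition word_tape : own_tape := (false, false, true).
Definition left_tape : own_tape := (false, true, false).
Definition right_tape : own_tape := (false, true, true).
Definition temp_tape : own_tape := (true, false, false).
Definition past_tape : own_tape := (true, false, true).
Definition future_tape : own_tape := (true, true, false).

Section SearchProgram.

Variables (I Tk X S : finType).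
Variable tok : bool -> Tk -> I -> option (Tk * seq I).
Variable tk0 : I -> Tk.
Variable tk1 : pred Tk.
Variable expand : bool -> Tk -> seq I.
Variables (lt : option I -> S) (unlt : S -> option (option I)).
Hypothesis ltK : pcancel lt unlt.

Local Notation J := (own_tape + X)%type.
Local Notation prog := (frag J S).
Local Notation ret := (@ret J S _).
Local Notation "m >>= k" := (@bind _ _ _ _ m k) (at level 55, k at level 200).
Local Notation "m ;; n" := (@bind _ _ unit _ m (fun _ => n)) (at level 60, right associativity).
Local Notation push j c := (@push J S (inl j) c).
Local Notation pop j := (pop S (inl j : J)).
Local Notation "[ 'loop' f ]" := (@loop J S unit _ (fun _ => f) tt).
Local Notation letters := (map (fun i : I => lt (Some i))).
Local Notation enc ws := (map lt (encode_words ws)).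
Implicit Types (g : own_tape -> seq S) (h : X -> ftape S).

Lemma enc_cons u ws : enc (u :: ws) = letters u ++ lt None :: enc ws.
Proof.
by rewrite /encode_words /= -cats1 !map_cat -map_comp -catA.
Qed.

(** Transferring letters between stacks reverses the entry, which is exactly the reversal that a
    change of side demands. *)
Definition move_entry (j1 j2 : own_tape) : prog unit :=
  push j2 (lt None) ;;
  [loop pop j1 >>= fun o =>
    if obind unlt o is Some (Some i) then push j2 (lt (Some i)) ;; ret (inl tt)
    else ret (inr tt)].

Lemma evs_move_entry j1 j2 u s g h : j1 != j2 -> g j1 = letters u ++ lt None :: s ->
  evs (move_entry j1 j2) g h tt
    (upd (upd g j1 s) j2 (letters (rev u) ++ lt None :: g j2)) h.
Proof.
move=> Hj Hg; apply: evs_bind; first exact: evs_push.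
have Hg1 : upd g j2 (lt None :: g j2) j1 = letters u ++ lt None :: s.
  by rewrite /upd (negPf Hj).
apply: (@evs_eq _ _ _ _ _ _ _ _ (upd (upd (upd g j2 (lt None :: g j2)) j1 s) j2
  (letters (rev u) ++ upd g j2 (lt None :: g j2) j2))); last first.
  by move=> j; rewrite /upd eqxx; case: eqP.
rewrite map_rev -catrevE; move: (upd g j2 _) Hg1 => {Hg}g.
elim: u g => [|i u IH] g Hg.
  apply: evs_loop_done; apply: evs_bind; first exact: evs_pop.
  rewrite Hg /= ltK; apply: evs_eq; first exact: evs_ret.
  by move=> j; rewrite /upd; case: (j =P j2) => // ->; rewrite eq_sym (negPf Hj).
apply: evs_loop_next.
  apply: evs_bind; first exact: evs_pop.
  rewrite Hg /= ltK; apply: evs_bind; first exact: evs_push.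
  exact: evs_ret.
apply: evs_eq; first by apply: IH; rewrite /upd (negPf Hj) eqxx.
move=> j; rewrite /upd eqxx (eq_sym j2) (negPf Hj); case: eqP => // _.
by case: eqP.
Qed.

(** The token is kept in the control state, which is where finiteness of the set of tokens is
    needed. *)
Definition sweep_prog (j : own_tape) (e : bool) (t : Tk) : prog (option Tk) :=
  loop (fun t => pop j >>= fun o =>
    match obind unlt o with
    | Some (Some i) =>
        if tok e t i is Some (t', w) then
          pushes _ temp_tape (letters w) ;; ret (inl t')
        else ret (inr None)
    | Some None => ret (inr (Some t))
    | None => ret (inr None)
    end) t.

(** A failure ends the trial, and both tapes are cleared before the next one, so their contents are
    left unspecified. *)
Lemma evs_sweep j e t u s g h : j != temp_tape -> g j = letters u ++ lt None :: s ->
  if sweep tok e t u is Some (t', w) then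
    evs (sweep_prog j e t) g h (Some t')
      (upd (upd g j s) temp_tape (letters (rev w) ++ g temp_tape)) h
  else exists2 g', evs (sweep_prog j e t) g h None g' h &
    forall j', j' \notin [:: j; temp_tape] -> g' j' = g j'.
Proof.
move=> Hj; elim: u t g => [|i u IH] t g Hg /=.
  apply: evs_loop_done; apply: evs_bind; first exact: evs_pop.
  rewrite Hg /= ltK; apply: evs_eq; first exact: evs_ret.
  by move=> j'; rewrite /upd; case: (j' =P temp_tape) => // ->; rewrite eq_sym (negPf Hj).
case E: (tok e t i) => [[t1 w1]|]; last first.
  exists (upd g j (letters u ++ lt None :: s)).
    apply: evs_loop_done; apply: evs_bind; first exact: evs_pop.
    by rewrite Hg /= ltK E; apply: evs_ret.
  by move=> j'; rewrite inE negb_or /upd => /andP [/negPf ->].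
pose g1 := upd (upd g j (letters u ++ lt None :: s)) temp_tape
  (rev (letters w1) ++ g temp_tape).
have H1 r g2 : evs (sweep_prog j e t1) g1 h r g2 h -> evs (sweep_prog j e t) g h r g2 h.
  apply: evs_loop_next; apply: evs_bind; first exact: evs_pop.
  rewrite Hg /= ltK E; apply: evs_bind; first exact: evs_pushes.
  apply: evs_eq; first exact: evs_ret.
  by move=> j'; rewrite [upd g j _ temp_tape]/upd eq_sym (negPf Hj).
have := IH t1 g1; rewrite /g1 {1}/upd (negPf Hj) upd_eq => /(_ erefl).
rewrite -/g1; case: (sweep tok e t1 u) => [[t' w]|] => [H2|[g' H2 Hg']].
  apply: evs_eq; first by apply/H1/H2.
  move=> j'; rewrite [g1 temp_tape]upd_eq rev_cat map_cat -catA [letters (rev w1)]map_rev /upd.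
  by case: eqP => // /eqP /negPf Ht; rewrite /g1 /upd Ht; case: eqP.
exists g'; first exact: H1.
move=> j' Hj'; rewrite Hg' //; move: Hj'; rewrite !inE negb_or => /andP [/negPf Hj1 /negPf Hj2].
by rewrite /g1 /upd Hj1 Hj2.
Qed.

Definition spawn_end : prog bool :=
  push left_tape (lt None) ;; move_all X S temp_tape left_tape ;; ret true.

Definition spawn_prog (e : bool) (i : I) : prog bool :=
  sweep_prog right_tape e (tk0 i) >>= fun o =>
  if o is Some t then
    if tk1 t then
      push right_tape (lt None) ;; move_all X S temp_tape right_tape ;;
      (sweep_prog left_tape e (tk0 i) >>= fun o' =>
      if o' is Some t' then
        is_empty X S left_tape >>= fun b =>
        if b then if tk1 t' then spawn_end else ret false
        else pushes _ left_tape (letters (expand e t')) ;; spawn_end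
      else ret false)
    else ret false
  else ret false.

Lemma evs_sweep_empty j e t g h : g j = [::] ->
  evs (sweep_prog j e t) g h None (upd g j [::]) h.
Proof.
move=> Hg; apply: evs_loop_done; apply: evs_bind; first exact: evs_pop.
by rewrite Hg; apply: evs_ret.
Qed.

Lemma evs_spawn_end g h s u : g left_tape = s -> g temp_tape = letters (rev u) ->
  evs spawn_end g h true (upd (upd g left_tape (letters u ++ lt None :: s)) temp_tape [::]) h.
Proof.
move=> Hl Ht; apply: evs_bind; first exact: evs_push.
apply: evs_bind; first exact: evs_move_all.
apply: evs_eq; first exact: evs_ret.
case=> -[[] []] []; rewrite /upd //=.
by rewrite Hl Ht -map_rev revK.
Qed.

Lemma evs_spawn e i ls rs g h :
  g left_tape = enc ls -> g right_tape = enc rs -> g temp_tape = [::] ->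
  if spawn tok tk0 tk1 expand e i ls rs is Some (ls', rs') then
    evs (spawn_prog e i) g h true
      (upd (upd g left_tape (enc ls')) right_tape (enc rs')) h
  else exists2 g', evs (spawn_prog e i) g h false g' h &
    forall j, j \notin [:: left_tape; right_tape; temp_tape] -> g' j = g j.
Proof.
move=> Hl Hr Ht.
have agree g1 g2 j0 : j0 \in [:: left_tape; right_tape] ->
    (forall j, j \notin [:: j0; temp_tape] -> g2 j = g1 j) ->
    (forall j, j \notin [:: left_tape; right_tape; temp_tape] -> g1 j = g j) ->
    forall j, j \notin [:: left_tape; right_tape; temp_tape] -> g2 j = g j.
  move=> Hj0 H2 H1 j Hj; rewrite H2 ?H1 //; move: Hj Hj0; rewrite !inE !negb_or.
  by move=> /and3P [Hjl Hjr ->] /orP [] /eqP ->; rewrite ?Hjl ?Hjr.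
have fail g1 : evs (sweep_prog right_tape e (tk0 i)) g h None g1 h ->
    (forall j, j \notin [:: right_tape; temp_tape] -> g1 j = g j) ->
    exists2 g', evs (spawn_prog e i) g h false g' h &
      forall j, j \notin [:: left_tape; right_tape; temp_tape] -> g' j = g j.
  move=> E H; exists g1; last by apply: agree H _.
  by apply: evs_bind; [exact: E | exact: evs_ret].
case: rs Hr => [|v rs] Hr.
  have -> : spawn tok tk0 tk1 expand e i ls [::] = None by case: (ls).
  apply: fail; first exact: evs_sweep_empty.
  by move=> j; rewrite inE negb_or /upd => /andP [/negPf ->].
rewrite enc_cons in Hr.
have := @evs_sweep right_tape e (tk0 i) v (enc rs) g h isT Hr.
have spawn_none : sweep tok e (tk0 i) v = None -> spawn tok tk0 tk1 expand e i ls (v :: rs) = None.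
  by rewrite /spawn; case: (ls) => // u l ->.
case Ev: (sweep tok e (tk0 i) v) spawn_none => [[t v']|] spawn_none; last first.
  by rewrite spawn_none // => -[g' H Hg']; apply: fail H Hg'.
move=> H1; case t1: (tk1 t); last first.
  have -> : spawn tok tk0 tk1 expand e i ls (v :: rs) = None.
    by rewrite /spawn; case: (ls) => // u l; rewrite Ev t1.
  eexists; first by apply: evs_bind; [exact: H1 | rewrite /= t1; exact: evs_ret].
  by case=> -[[] []] [].
pose g1 := upd (upd g right_tape (enc (v' :: rs))) temp_tape [::].
have Hpre r g' : evs (sweep_prog left_tape e (tk0 i) >>= fun o' =>
      if o' is Some t' then
        is_empty X S left_tape >>= fun b =>
        if b then if tk1 t' then spawn_end else ret false
        else pushes _ left_tape (letters (expand e t')) ;; spawn_end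
      else ret false) g1 h r g' h -> evs (spawn_prog e i) g h r g' h.
  move=> H; apply: evs_bind; first exact: H1.
  rewrite /= t1; apply: evs_bind; first exact: evs_push.
  apply: evs_bind; last exact: H.
  apply: evs_eq; first exact: evs_move_all.
  case=> -[[] []] []; rewrite /g1 /upd //= Ht cats0.
  by rewrite enc_cons -map_rev revK.
have Hg1 j : j \notin [:: left_tape; right_tape; temp_tape] -> g1 j = g j.
  by case: j => -[[] []] [].
case: ls Hl {spawn_none} => [|u ls] Hl /=.
  exists (upd g1 left_tape [::]).
    apply: Hpre; apply: evs_bind; first exact: evs_sweep_empty.
    exact: evs_ret.
  apply: (agree g1 _ left_tape) => // j.
  by rewrite inE negb_or {1}/upd => /andP [/negPf ->].
rewrite /spawn Ev t1; rewrite enc_cons in Hl.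
have Hl1 : g1 left_tape = letters u ++ lt None :: enc ls by [].
have := @evs_sweep left_tape e (tk0 i) u (enc ls) g1 h isT Hl1.
case: (sweep tok e (tk0 i) u) => [[t' u']|] => [H2|[g' H2 Hg']]; last first.
  exists g'; last exact: (agree g1 _ left_tape isT Hg' Hg1).
  by apply: Hpre; apply: evs_bind; [exact: H2 | exact: evs_ret].
set g2 := upd _ _ _ in H2.
have Hg2 j : j \notin [:: left_tape; right_tape; temp_tape] -> g2 j = g j.
  by case: j => -[[] []] [].
have Hl2 : g2 left_tape = enc ls by [].
have Ht2 : g2 temp_tape = letters (rev u') by rewrite /g2 upd_eq /g1 upd_eq cats0.
have Hr2 : g2 right_tape = enc (v' :: rs) by [].
clearbody g2; move: Hl2 {H1 Hl Hl1}; case: ls => [|u2 ls] Hl2.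
  case t1': (tk1 t').
    apply: evs_eq.
      apply: Hpre; apply: evs_bind; first exact: H2.
      apply: evs_bind; first exact: evs_is_empty.
      by rewrite Hl2 /= t1'; apply: evs_spawn_end Hl2 Ht2.
    case=> -[[] []] []; rewrite /upd /= ?Ht ?enc_cons //; try exact: Hg2.
    by rewrite -enc_cons.
  exists g2; last exact: Hg2.
  apply: Hpre; apply: evs_bind; first exact: H2.
  apply: evs_bind; first exact: evs_is_empty.
  by rewrite Hl2 /= t1'; apply: evs_ret.
apply: evs_eq.
  apply: Hpre; apply: evs_bind; first exact: H2.
  apply: evs_bind; first exact: evs_is_empty.
  rewrite Hl2 enc_cons; have -> a (b : S) c : nilp (a ++ b :: c) = false by case: a.
  apply: evs_bind; first exact: evs_pushes.
  apply: evs_spawn_end; last exact: Ht2.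
  by rewrite upd_eq Hl2 enc_cons catA -map_rev -map_cat.
case=> -[[] []] []; rewrite /upd /= ?Ht ?enc_cons //; try exact: Hg2.
by rewrite -enc_cons.
Qed.

Definition rewind_prog : prog unit :=
  [loop is_empty X S left_tape >>= fun b =>
    if b then ret (inr tt) else move_entry left_tape right_tape ;; ret (inl tt)].

Lemma evs_rewind ls rs g h : g left_tape = enc ls -> g right_tape = enc rs ->
  evs rewind_prog g h tt (upd (upd g left_tape [::]) right_tape (enc (rewind ls rs))) h.
Proof.
elim: ls rs g => [|u ls IH] rs g Hl Hr.
  apply: evs_loop_done; apply: evs_bind; first exact: evs_is_empty.
  rewrite Hl; apply: evs_eq; first exact: evs_ret.
  by case=> -[[] []] [] //=; rewrite /upd /= ?Hl ?Hr.
rewrite enc_cons in Hl; apply: evs_loop_next.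
  apply: evs_bind; first exact: evs_is_empty.
  rewrite Hl; have -> a (b : S) c : nilp (a ++ b :: c) = false by case: a.
  apply: evs_bind; first by apply: evs_move_entry Hl.
  exact: evs_ret.
apply: evs_eq; first by apply: (IH (rev u :: rs)); rewrite /upd //= Hr enc_cons.
by case=> -[[] []] [].
Qed.

Definition all_trivial_prog : prog bool :=
  [loop pop left_tape >>= fun o =>
    match obind unlt o with
    | Some (Some _) => ret (inr false)
    | Some None => ret (inl tt)
    | None => ret (inr true)
    end].

Lemma evs_all_trivial ls g h : g left_tape = enc ls ->
  exists2 g', evs all_trivial_prog g h (all (@nilp I) ls) g' h &
    forall j, j != left_tape -> g' j = g j.
Proof.
elim: ls g => [|u ls IH] g Hg.
  eexists.
    apply: evs_loop_done; apply: evs_bind; first exact: evs_pop.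
    by rewrite Hg; apply: evs_ret.
  by move=> j; rewrite /upd => /negPf ->.
rewrite enc_cons in Hg; case: u Hg => [|i u] Hg /=; last first.
  eexists.
    apply: evs_loop_done; apply: evs_bind; first exact: evs_pop.
    by rewrite Hg /= ltK; apply: evs_ret.
  by move=> j; rewrite /upd => /negPf ->.
have [|g' H Hg'] := IH (upd g left_tape (enc ls)); first by rewrite upd_eq.
exists g'; last by move=> j Hj; rewrite Hg' // /upd (negPf Hj).
apply: evs_loop_next; last exact: H.
apply: evs_bind; first exact: evs_pop.
by rewrite Hg /= ltK; apply: evs_ret.
Qed.

(** An exhausted [future_tape] yields [None], the default choice c0 of [trial]. *)
Definition choose : prog (option I) :=
  pop future_tape >>= fun o => let c := odflt None (obind unlt o) in
  push past_tape (lt c) ;; ret c.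

Lemma evs_choose C D g h : g past_tape = map lt C -> g future_tape = map lt D ->
  let c := head None D in
  evs choose g h c
    (upd (upd g past_tape (map lt (c :: C))) future_tape (map lt (behead D))) h.
Proof.
move=> HC HD /=; apply: evs_bind; first exact: evs_pop.
have -> : odflt None (obind unlt (ohead (g future_tape))) = head None D.
  by rewrite HD; case: D {HD} => //= c D; rewrite ltK.
apply: evs_bind; first exact: evs_push.
apply: evs_eq; first exact: evs_ret.
by case=> -[[] []] [] //=; rewrite /upd /= ?HC ?HD -?map_behead //; case: (D).
Qed.

(** The loop parameter is the parity of the number of entries on the left, which selects the side of
    a reduction; a rewind resets it to false. *)
Definition trial_body (e : bool) : prog (bool + bool) :=
  is_empty X S right_tape >>= fun b =>
  if b then all_trivial_prog >>= fun r => ret (inr r)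
  else choose >>= fun c =>
    if c is Some i then
      spawn_prog e i >>= fun ok =>
      if ok then rewind_prog ;; ret (inl false) else ret (inr false)
    else move_entry right_tape left_tape ;; ret (inl (~~ e)).

Let advance := advance tok tk0 tk1 expand.
Let trial := trial (@leaf I) advance None.

Lemma nilp_enc_cons u ws : nilp (enc (u :: ws)) = false.
Proof. by rewrite enc_cons; case: u. Qed.

Definition kept : seq own_tape := [:: in_tape; word_tape].

Lemma evs_trial_step ls v rs C D g h :
  g left_tape = enc ls -> g right_tape = enc (v :: rs) -> g temp_tape = [::] ->
  g past_tape = map lt C -> g future_tape = map lt D ->
  let c := head None D in
  exists g', [/\ g' past_tape = map lt (c :: C), g' future_tape = map lt (behead D),
    {in kept, g' =1 g} &
    if advance (Some (ls, v :: rs)) c is Some (ls', rs') then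
      [/\ evs (trial_body (odd (size ls))) g h (inl (odd (size ls'))) g' h,
        g' left_tape = enc ls', g' right_tape = enc rs' & g' temp_tape = [::]]
    else evs (trial_body (odd (size ls))) g h (inr false) g' h].
Proof.
move=> Hl Hr Ht HC HD c.
pose g1 := upd (upd g past_tape (map lt (c :: C))) future_tape (map lt (behead D)).
have start r g' : evs (if c is Some i then
      spawn_prog (odd (size ls)) i >>= fun ok =>
      if ok then rewind_prog ;; ret (inl false) else ret (inr false)
    else move_entry right_tape left_tape ;; ret (inl (~~ odd (size ls)))) g1 h r g' h ->
    evs (trial_body (odd (size ls))) g h r g' h.
  move=> H; apply: evs_bind; first exact: evs_is_empty.
  rewrite Hr nilp_enc_cons; apply: evs_bind; first exact: evs_choose HC HD.
  exact: H.
have Hg1 : {in kept, g1 =1 g} by case=> -[[] []] [].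
move: start; case: c @g1 Hg1 => [i|] g1 Hg1 start /=; last first.
  exists (upd (upd g1 right_tape (enc rs)) left_tape (letters (rev v) ++ lt None :: enc ls)).
  split=> //; first by case=> -[[] []] [].
  split=> //; last by rewrite enc_cons.
  apply: start; apply: evs_bind; last exact: evs_ret.
  by rewrite -Hl; apply: evs_move_entry; rewrite // -enc_cons.
have := @evs_spawn (odd (size ls)) i ls (v :: rs) g1 h Hl Hr Ht.
case: spawn => [[ls' rs']|] => [H|[g' H Hg']]; last first.
  exists g'; split; rewrite ?Hg' //; first by move=> j Hj; rewrite Hg' ?Hg1 //; case: j Hj => -[[] []] [].
  by apply: start; apply: evs_bind; [exact: H | exact: evs_ret].
pose g2 := upd (upd g1 left_tape (enc ls')) right_tape (enc rs').
exists (upd (upd g2 left_tape [::]) right_tape (enc (rewind ls' rs'))).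
split=> //; first by case=> -[[] []] [].
split=> //; apply: start; apply: evs_bind; first exact: H.
by apply: evs_bind; [apply: evs_rewind | exact: evs_ret].
Qed.

Lemma evs_trial x C D b C' : trial x C D b C' ->
  forall ls rs g h, x = Some (ls, rs) ->
  g left_tape = enc ls -> g right_tape = enc rs -> g temp_tape = [::] ->
  g past_tape = map lt C -> g future_tape = map lt D ->
  exists g', [/\ evs (loop trial_body (odd (size ls))) g h b g' h,
    g' past_tape = map lt C', g' future_tape = [::] & {in kept, g' =1 g}].
Proof.
have failed C1 D1 b1 C1' : trial None C1 D1 b1 C1' -> [/\ D1 = [::], b1 = false & C1' = C1].
  move Ey: None => y H.
  by case: H Ey => [b2 E | c D2 b2 C2 E _ | b2 C2 E _] Ey; move: E; rewrite -Ey // => -[<-].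
(* Writing the choice as [head None D1] treats recorded and default choices together. *)
have next_case y C1 D1 b1 C1' ls rs g h : y = Some (ls, rs) -> leaf y = None ->
    trial (advance y (head None D1)) (head None D1 :: C1) (behead D1) b1 C1' ->
    (forall ls' rs' g' h, advance y (head None D1) = Some (ls', rs') ->
      g' left_tape = enc ls' -> g' right_tape = enc rs' -> g' temp_tape = [::] ->
      g' past_tape = map lt (head None D1 :: C1) -> g' future_tape = map lt (behead D1) ->
      exists g'', [/\ evs (loop trial_body (odd (size ls'))) g' h b1 g'' h,
        g'' past_tape = map lt C1', g'' future_tape = [::] & {in kept, g'' =1 g'}]) ->
    g left_tape = enc ls -> g right_tape = enc rs -> g temp_tape = [::] ->
    g past_tape = map lt C1 -> g future_tape = map lt D1 ->
    exists g', [/\ evs (loop trial_body (odd (size ls))) g h b1 g' h,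
      g' past_tape = map lt C1', g' future_tape = [::] & {in kept, g' =1 g}].
  move=> ->; case: rs => // v rs _ Ht IH Hl Hr HE HC HD.
  have [g1 [HC1 HD1 Hg1]] := evs_trial_step h Hl Hr HE HC HD.
  case E: (advance _ _) Ht => [[ls' rs']|] Ht.
    move=> [H Hl1 Hr1 HE1]; have [g2 [H2 HC2 HD2 Hg2]] := IH _ _ g1 h E Hl1 Hr1 HE1 HC1 HD1.
    exists g2; split=> // [|j Hj]; last by rewrite Hg2 ?Hg1.
    exact: evs_loop_next H H2.
  have [ED -> ->] := failed _ _ _ _ Ht; move=> H; exists g1; split=> //.
    exact: evs_loop_done.
  by rewrite HD1 ED.
elim=> {x C D b C'} [x C b E | x C c D b C' E Ht IH | x C b C' E Ht IH] ls rs g h Ex Hl Hr HE HC HD.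
- move: E; rewrite Ex; case: rs Hr {Ex} => //= Hr [<-].
  have [g' H Hg'] := evs_all_trivial h Hl.
  exists g'; split; rewrite ?Hg' //; last by case=> -[[] []] [] // _; rewrite Hg'.
  apply: evs_loop_done; apply: evs_bind; first exact: evs_is_empty.
  by rewrite Hr; apply: evs_bind; [exact: H | exact: evs_ret].
- apply: (next_case x C (c :: D) b C' ls rs g h Ex E Ht _ Hl Hr HE HC HD).
  by move=> ls' rs' g' h' E'; apply: IH.
- apply: (next_case x C [::] b C' ls rs g h Ex E Ht _ Hl Hr HE HC HD).
  by move=> ls' rs' g' h' E'; apply: IH.
Qed.

Section Backtracking.

Variable cs0 : seq (option I).
Let choice_succ := choice_succ None cs0.

Definition backtrack_prog : prog bool :=
  [loop pop past_tape >>= fun o =>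
    if obind unlt o is Some c then
      if choice_succ c is Some c' then
        push past_tape (lt c') ;; move_all X S past_tape future_tape ;; ret (inr true)
      else ret (inl tt)
    else ret (inr false)].

(** The reversal performed by [move_all] is the [rev] of [backtrack]. *)
Lemma evs_backtrack C g h : g past_tape = map lt C -> g future_tape = [::] ->
  evs backtrack_prog g h (backtrack None cs0 C)
    (upd (upd g past_tape [::]) future_tape (map lt (odflt [::] (backtrack None cs0 C)))) h.
Proof.
elim: C g => [|c C IH] g HC HD /=.
  apply: evs_loop_done; apply: evs_bind; first exact: evs_pop.
  rewrite HC /=; apply: evs_eq; first exact: evs_ret.
  by case=> -[[] []] []; rewrite /upd /= ?HC ?HD.
rewrite -/choice_succ; case E: (choice_succ c) => [c'|].
  apply: evs_loop_done; apply: evs_bind; first exact: evs_pop.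
  rewrite HC /= ltK E; apply: evs_bind; first exact: evs_push.
  apply: evs_bind; first exact: evs_move_all.
  apply: evs_eq; first exact: evs_ret.
  case=> -[[] []] []; rewrite /upd /= ?HD ?cats0 //.
  by rewrite map_rev.
apply: evs_loop_next.
  apply: evs_bind; first exact: evs_pop.
  by rewrite HC /= ltK E; apply: evs_ret.
apply: evs_eq; first by apply: IH; rewrite /upd.
by case=> -[[] []] [].
Qed.

(** The detour through [temp_tape] is needed because each transfer reverses a stack: two of them
    restore [word_tape] and give a copy in the right order. *)
Definition dfs_prog : prog bool :=
  [loop move_all X S word_tape temp_tape ;; copy_all X S temp_tape word_tape right_tape ;;
    (loop trial_body false >>= fun b =>
    if b then ret (inr true)
    else clear X S left_tape ;; clear X S right_tape ;; clear X S temp_tape ;;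
      (backtrack_prog >>= fun ok =>
      if ok then ret (inl tt) else ret (inr false)))].

Lemma evs_dfs ws D b : searches (@leaf I) advance None cs0 (Some ([::], ws)) D b ->
  forall g h, g word_tape = enc ws -> g left_tape = [::] -> g right_tape = [::] ->
  g temp_tape = [::] -> g past_tape = [::] -> g future_tape = map lt D ->
  exists2 g', evs dfs_prog g h b g' h & g' in_tape = g in_tape.
Proof.
move=> Hdfs g h.
have start r C D' b' g0 : trial (Some ([::], ws)) [::] D' b' C ->
    g0 word_tape = enc ws -> g0 left_tape = [::] -> g0 right_tape = [::] ->
    g0 temp_tape = [::] -> g0 past_tape = [::] -> g0 future_tape = map lt D' ->
    exists g1, [/\ g1 past_tape = map lt C, g1 future_tape = [::], {in kept, g1 =1 g0} &
    forall g2, evs (if b' then ret (inr true)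
    else clear X S left_tape ;; clear X S right_tape ;; clear X S temp_tape ;;
      (backtrack_prog >>= fun ok =>
      if ok then ret (inl tt) else ret (inr false))) g1 h r g2 h ->
    evs (move_all X S word_tape temp_tape ;; copy_all X S temp_tape word_tape right_tape ;;
    (loop trial_body false >>= fun b =>
    if b then ret (inr true)
    else clear X S left_tape ;; clear X S right_tape ;; clear X S temp_tape ;;
      (backtrack_prog >>= fun ok =>
      if ok then ret (inl tt) else ret (inr false)))) g0 h r g2 h].
  move=> Ht HW Hl Hr HE HC HD.
  pose g1 := upd g0 right_tape (enc ws).
  have [|||||g2 [H HC2 HD2 Hg2]] := evs_trial (g := g1) Ht h erefl; rewrite ?/g1 ?/upd //.
  exists g2; split=> // [j Hj|g3 H3]; first by rewrite Hg2 //; move: j Hj; case=> -[[] []] [].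
  apply: evs_bind; first exact: evs_move_all.
  apply: (@evs_bind _ _ _ _ _ _ _ _ _ tt g1 h).
    apply: evs_eq; first exact: evs_copy_all.
    by case=> -[[] []] []; rewrite /g1 /upd //= ?HW ?HE ?Hr ?cats0 ?revK.
  by apply: evs_bind; [exact: H | exact: H3].
have branch (b1 : bool) g1 : evs (if b1 then ret (inl tt) else ret (inr false)) g1 h
    (if b1 then inl tt else inr false : unit + bool) g1 h.
  by case: b1; apply: evs_ret.
have cleared C g1 : g1 past_tape = map lt C -> g1 future_tape = [::] ->
    let o := backtrack None cs0 C in
    exists g2, [/\ evs (clear X S left_tape ;; clear X S right_tape ;; clear X S temp_tape ;;
      (backtrack_prog >>= fun ok =>
      if ok then ret (inl tt) else ret (inr false))) g1 h (if o then inl tt else inr false) g2 h,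
      [/\ g2 left_tape = [::], g2 right_tape = [::], g2 temp_tape = [::], g2 past_tape = [::] &
      g2 future_tape = map lt (odflt [::] o)] & {in kept, g2 =1 g1}].
  move=> HC HD o; eexists; split.
  - do 3!(apply: evs_bind; first exact: evs_clear).
    apply: evs_bind; first by apply: (@evs_backtrack C); rewrite /upd.
    exact: branch.
  - by rewrite /upd.
  - by case=> -[[] []] [].
elim: Hdfs g => {D b} [D b C Ht Hb | D b C Ht EC Hb | D b C D' Ht EC _ IH] g HW Hl Hr HE HP HD.
- have [g1 [_ _ Hg1 H]] := start (inr b) _ _ _ _ Ht HW Hl Hr HE HP HD.
  exists g1; last by rewrite Hg1.
  by apply: evs_loop_done; apply: H; rewrite Hb; apply: evs_ret.
- have [g1 [HC1 HD1 Hg1 H]] := start (inr b) _ _ _ _ Ht HW Hl Hr HE HP HD.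
  have [g2 []] := cleared _ _ HC1 HD1; rewrite EC => H2 _ Hg2.
  exists g2; last by rewrite Hg2 ?Hg1.
  by apply: evs_loop_done; apply: H; rewrite (negPf Hb).
have [g1 [HC1 HD1 Hg1 H]] := start (inl tt) _ _ _ _ Ht HW Hl Hr HE HP HD.
have [g2 []] := cleared _ _ HC1 HD1; rewrite EC => H2 [Hl2 Hr2 HE2 HP2 HD2] Hg2.
have [|g3 H3 Hg3] := IH g2 _ Hl2 Hr2 HE2 HP2 HD2; first by rewrite Hg2 ?Hg1.
exists g3; last by rewrite Hg3 Hg2 ?Hg1.
by apply: evs_loop_next H3; apply: H.
Qed.

End Backtracking.

End SearchProgram.

Lemma encode_words_cat (A : finType) (ws1 ws2 : seq (seq A)) :
  encode_words (ws1 ++ ws2) = encode_words ws1 ++ encode_words ws2.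
Proof. by rewrite /encode_words map_cat flatten_cat. Qed.

(* The letter s_i becomes s_i / 1, and its formal inverse 1 / s_i. *)
Definition letter_words (A : Type) (p : A * bool) : seq (seq A) :=
  if p.2 then [:: [::]; [:: p.1]] else [:: [:: p.1]; [::]].
Definition signed_words (A : Type) (w : seq (A * bool)) : seq (seq A) :=
  flatten (map (@letter_words A) w).

(** * Running the machine for f inside the decision machine *)

Section MainProgram.

Variables (I Tk : finType).
Variable tok : bool -> Tk -> I -> option (Tk * seq I).
Variable tk0 : I -> Tk.
Variable tk1 : pred Tk.
Variable expand : bool -> Tk -> seq I.
Variable T : turing_machine (option I) unit.

Local Notation X := 'I_(tm_aux_tapes T).+1.
Definition symbol : finType := (tm_symbol T + ((I * bool) + (bool + option I)))%type.
Local Notation S := symbol.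
Local Notation J := (own_tape + X)%type.
Implicit Types (g : own_tape -> seq S) (h : X -> ftape S).

Definition machine_symbol (c : tm_symbol T) : S := inl c.
Definition input_symbol (c : I * bool) : S := inr (inl c).
Definition output_symbol (b : bool) : S := inr (inr (inl b)).
Definition letter_symbol (c : option I) : S := inr (inr (inr c)).
Definition of_machine_symbol (c : S) : option (tm_symbol T) := if c is inl x then Some x else None.
Definition of_input_symbol (c : S) : option (I * bool) :=
  if c is inr (inl x) then Some x else None.
Definition of_letter_symbol (c : S) : option (option I) :=
  if c is inr (inr (inr x)) then Some x else None.

Local Notation prog := (frag J S).
Local Notation ret := (@ret J S _).
Local Notation "m >>= k" := (@bind _ _ _ _ m k) (at level 55, k at level 200).
Local Notation "m ;; n" := (@bind _ _ unit _ m (fun _ => n)) (at level 60, right associativity).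
Local Notation push j c := (@push J S j c).
Local Notation pop j := (pop S (j : J)).
Local Notation "[ 'loop' f ]" := (@loop J S unit _ (fun _ => f) tt).
Local Notation raw0 := (inr ord0 : J).

Definition raw_cells (l : seq (option (tm_symbol T))) : nat -> option S :=
  fun n => omap machine_symbol (nth None l n).
Definition raw_tape (t : tape T) : ftape S := (raw_cells t.1, raw_cells t.2).

Lemma raw_tape_act t a :
  raw_tape (tape_act t a) = ftape_act (raw_tape t) (omap machine_symbol a.1, a.2).
Proof.
case: t => l r; case: a => c mv; rewrite /ftape_act /raw_tape /=.
have Hb u : raw_cells (behead u) = stail (raw_cells u).
  by apply: functional_extensionality => n; rewrite /raw_cells nth_behead.
have Hc x u : raw_cells (x :: u) = scons (omap machine_symbol x) (raw_cells u).
  by apply: functional_extensionality; case.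
by case: mv; rewrite /= ?Hc ?Hb // [raw_cells l 0]/raw_cells nth0.
Qed.

(** Foreign symbols would be read as blanks, but tapes of the form [raw_tape] contain none. *)
Definition call_code (q : tm_state T) :
    unit + ((J -> option S) -> tm_state T * (J -> action S)) :=
  if tm_final q then inl tt
  else inr (fun rd =>
    let r := tm_trans q [ffun i => obind of_machine_symbol (rd (inr i))] in
    (r.1, fun j => if j is inr i then (omap machine_symbol (r.2 i).1, (r.2 i).2)
                   else (rd j, Stay))).

Definition call_prog : prog unit := Frag (tm_start T) call_code.

Lemma evs_call w v g h :
  tm_computes T w v -> (forall i, h i = raw_tape ((tm_init T w).2 i)) ->
  exists2 h', evs call_prog g h tt g h' &
    holds (map (fun y => machine_symbol (tm_out T y)) v) (h' ord0).2.
Proof.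
move=> [t [Hf Ho]] Hh.
exists (fun i => raw_tape ((iter t (@tm_step _ _ T) (tm_init T w)).2 i)); last first.
  rewrite (map_comp machine_symbol) -Ho /tm_output /raw_tape /=.
  case: (_ ord0) => l r /=; elim: r => [//|[c|] r IH] //=.
move=> ts [Hg Hts].
suff [ts' H1 [H2 H3]] : exists2 ts', runs call_code (tm_init T w).1 ts tt ts' &
    (forall j, ts' (inl j) = ts (inl j)) /\
    (forall i, ts' (inr i) = raw_tape ((iter t (@tm_step _ _ T) (tm_init T w)).2 i)).
  by exists ts' => //; split=> // j; rewrite H2.
have {h Hh}Hts i : ts (inr i) = raw_tape ((tm_init T w).2 i) by rewrite Hts Hh.
elim: t (tm_init T w) ts {Hg Ho} Hf Hts => [|t IH] c ts Hf Hts.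
  by exists ts => //; apply: runs_final; rewrite /call_code Hf.
(* T may halt before t steps; a final configuration is then a fixed point of [tm_step]. *)
case Hq: (tm_final c.1).
  have Hc n : iter n (@tm_step _ _ T) c = c.
    by elim: n => //= n ->; rewrite /tm_step; case: c Hq {Hf Hts} => q tp /= ->.
  by exists ts; rewrite ?Hc //; apply: runs_final; rewrite /call_code Hq.
move: Hf; rewrite iterSr => Hf.
pose a := tm_trans c.1 [ffun i => tape_read (c.2 i)].
have Ec : tm_step c = (a.1, [ffun i => tape_act (c.2 i) (a.2 i)]).
  by rewrite /tm_step /a; case: (c) Hq => q tp /= ->; case: (tm_trans _ _).
pose ts1 : J -> ftape S := fun j =>
  if j is inr i then raw_tape ((tm_step c).2 i) else ts j.
have [ts' H1 [H2 H3]] := IH (tm_step c) ts1 Hf (fun _ => erefl).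
exists ts'; last by split=> // j; rewrite H2.
apply: runs_step; first by rewrite /call_code Hq.
have -> : [ffun i => obind of_machine_symbol (scan ts (inr i))] =
    [ffun i => tape_read (c.2 i)] :> {ffun X -> option (tm_symbol T)}.
  apply/ffunP => i; rewrite !ffunE /scan Hts /= /raw_cells nth0 /tape_read.
  by case: (head _ _).
rewrite -/a /=; have -> : act ts (fun j => if j is inr i
    then (omap machine_symbol (a.2 i).1, (a.2 i).2) else (scan ts j, Stay)) = ts1.
  apply: functional_extensionality => -[j|i]; rewrite /act /ts1.
    exact: ftape_act_stay.
  by rewrite Hts -raw_tape_act Ec ffunE.
by move: H1; rewrite Ec.
Qed.

Definition raw_init (s : seq (option I)) : X -> ftape S :=
  upd (fun _ => raw_tape ([::], [::])) ord0 (raw_tape ([::], [seq Some (tm_in T c) | c <- s])).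

(** The multifraction is written twice: the machine for f consumes one copy, and [word_tape] keeps
    the other. *)
Definition push_both (s : seq (option I)) : prog unit :=
  foldr (fun c m => m ;; push (inl word_tape) (letter_symbol c) ;;
                    push raw0 (machine_symbol (tm_in T c))) (ret tt) s.

Lemma evs_push_both s s0 g : g word_tape = map letter_symbol s0 ->
  evs (push_both s) g (raw_init s0) tt
    (upd g word_tape (map letter_symbol (s ++ s0))) (raw_init (s ++ s0)).
Proof.
move=> Hg; elim: s => [|c s IH] /=.
  apply: evs_eq; first exact: evs_ret.
  by move=> j; rewrite /upd; case: eqP => // ->.
apply: evs_bind; first exact: IH.
apply: evs_bind; first exact: evs_push.
rewrite upd_eq upd_upd.
rewrite (_ : raw_init (c :: _) = upd (raw_init (s ++ s0)) ord0
  (stail (raw_init (s ++ s0) ord0).1, scons (Some (machine_symbol (tm_in T c)))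
    (raw_init (s ++ s0) ord0).2)); first exact: evs_push_raw.
(* The left half stays blank under pushes, so the result is again an exact initial tape of T. *)
rewrite /raw_init upd_upd upd_eq; congr upd; congr pair.
  by apply: functional_extensionality => n; rewrite /stail /raw_cells !nth_nil.
by apply: functional_extensionality; case.
Qed.

(** The input arrives reversed on [future_tape]; pushing its last letter first leaves the output in
    reading order. *)
Definition parse_prog : prog unit :=
  [loop pop (inl future_tape) >>= fun o =>
    if obind of_input_symbol o is Some p then
      push_both (encode_words (letter_words p)) ;; ret (inl tt)
    else ret (inr tt)].

Lemma evs_parse q s g : g future_tape = map input_symbol q -> g word_tape = map letter_symbol s ->
  let s' := encode_words (signed_words (rev q)) ++ s in
  evs parse_prog g (raw_init s) tt
    (upd (upd g future_tape [::]) word_tape (map letter_symbol s')) (raw_init s').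
Proof.
elim: q s g => [|p q IH] s g Hq Hs /=.
  apply: evs_loop_done; apply: evs_bind; first exact: evs_pop.
  rewrite Hq /=; apply: evs_eq; first exact: evs_ret.
  by case=> -[[] []] []; rewrite /upd /= ?Hs.
have Es : encode_words (signed_words (rev (p :: q))) ++ s =
    encode_words (signed_words (rev q)) ++ (encode_words (letter_words p) ++ s).
  by rewrite rev_cons -cats1 /signed_words map_cat flatten_cat encode_words_cat -catA /= cats0.
rewrite Es; apply: evs_loop_next.
  apply: evs_bind; first exact: evs_pop.
  rewrite Hq /=; apply: evs_bind; last exact: evs_ret.
  by apply: evs_push_both; rewrite /upd.
apply: evs_eq; first by apply: IH; rewrite /upd.
by case=> -[[] []] [].
Qed.

(** A trivial entry is encoded by its terminator alone, so each unary digit of f(a) is turned into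
    two terminators. *)
Definition pad_prog : prog unit :=
  [loop pop raw0 >>= fun o =>
    if o is Some _ then
      push (inl word_tape) (letter_symbol None) ;; push (inl word_tape) (letter_symbol None) ;;
      ret (inl tt)
    else ret (inr tt)].

Lemma evs_pad s ws g h : holds s (h ord0).2 -> g word_tape = map letter_symbol (encode_words ws) ->
  exists h', evs pad_prog g h tt (upd g word_tape
    (map letter_symbol (encode_words (nseq (2 * size s) [::] ++ ws)))) h'.
Proof.
elim: s ws g h => [|c s IH] ws g h Hs Hg; have [h1 H1 Hs1] := evs_pop_raw g Hs.
  exists h1; apply: evs_loop_done; apply: evs_bind; first exact: H1.
  apply: evs_eq; first exact: evs_ret.
  by move=> j; rewrite /upd; case: eqP => // ->.
pose g1 := upd g word_tape (map letter_symbol (encode_words ([:: [::]; [::]] ++ ws))).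
have [|h2 H2] := IH ([:: [::]; [::]] ++ ws) g1 h1 Hs1; first by rewrite /g1 upd_eq.
exists h2; apply: evs_loop_next.
  apply: evs_bind; first exact: H1.
  apply: evs_bind; first exact: evs_push.
  apply: evs_bind; first exact: evs_push.
  exact: evs_ret.
rewrite upd_upd upd_eq Hg; apply: evs_eq; first exact: H2.
rewrite /g1 => j; rewrite upd_upd; congr (upd _ _ _ j); congr map; congr encode_words.
by rewrite catA; congr (_ ++ _); rewrite -[[:: _; _]]/(nseq 2 [::]) -nseqD mulnS addnC.
Qed.

Definition main_prog (cs : seq (option I)) : prog unit :=
  move_all X S in_tape future_tape ;; parse_prog ;; call_prog ;; pad_prog ;;
  (dfs_prog X tok tk0 tk1 expand letter_symbol of_letter_symbol cs >>= fun b =>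
    push (inl in_tape) (output_symbol b)).

Lemma ev_main cs w n b : tm_computes T (encode_words (signed_words w)) (unary n) ->
  searches (@leaf I) (advance tok tk0 tk1 expand) None cs
    (Some ([::], nseq (2 * n) [::] ++ signed_words w)) [::] b ->
  exists2 ts, ev (main_prog cs) (initial_tapes input_symbol (inl in_tape : J) w) tt ts &
    holds (map output_symbol [:: b]) (ts (inl in_tape)).2.
Proof.
move=> HT Hsearch; pose g0 : own_tape -> seq S := upd (fun _ => [::]) in_tape (map input_symbol w).
suff [g' [h' [H Hg']]] : exists g' h',
    evs (main_prog cs) g0 (raw_init [::]) tt g' h' /\ g' in_tape = [:: output_symbol b].
  have [|ts Hts [Hs _]] := H (initial_tapes input_symbol (inl in_tape : J) w).
    split=> [j|i].
      rewrite /initial_tapes /g0 /upd; have -> : (inl j == inl in_tape :> J) = (j == in_tape) by [].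
      by case: eqP => //= _; elim: (w) => //= p w' IH; split.
    have -> : raw_init [::] i = raw_tape ([::], [::]) by rewrite /raw_init /upd; case: eqP.
    by congr pair; apply: functional_extensionality => k; rewrite /raw_cells !nth_nil.
  by exists ts => //; have := Hs in_tape; rewrite Hg'.
have letterK : pcancel letter_symbol of_letter_symbol by [].
pose sw := encode_words (signed_words w).
pose g1 := upd g0 in_tape [::].
pose g2 := upd g1 word_tape (map letter_symbol sw).
have [|h3 H3 Hh3] := @evs_call sw (unary n) g2 (raw_init sw) HT.
  by move=> i; rewrite /raw_init /tm_init ffunE /upd; case: eqP.
have [|h4 H4] := evs_pad (ws := signed_words w) Hh3 (g := g2); first by rewrite /g2 upd_eq.
rewrite size_map size_nseq in H4.
set g4 := upd _ _ _ in H4.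
have [||||||g5 H5 Hg5] := evs_dfs letterK Hsearch (g := g4) h4 => //.
exists (upd g5 in_tape (output_symbol b :: g5 in_tape)), h4; split; last by rewrite upd_eq Hg5.
apply: evs_bind; first exact: evs_move_all.
apply: (@evs_bind _ _ _ _ _ _ _ _ _ tt g2 (raw_init sw)).
  have Esw : sw = encode_words (signed_words (rev (rev w))) ++ [::] by rewrite revK cats0.
  rewrite Esw; apply: evs_eq; first by apply: evs_parse; rewrite /g0 /upd /= ?cats0 ?map_rev.
  by case=> -[[] []] []; rewrite /g2 /upd //= Esw.
apply: evs_bind; first exact: H3.
apply: evs_bind; first exact: H4.
apply: evs_bind; first exact: H5.
exact: evs_push.
Qed.

End MainProgram.

(** * Weights and finite tables extracted from M *)

Section Tables.

Variable M : monoidType.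
Hypothesis M_gcd : gcd_monoid M.
Variables (k : nat) (s : 'I_k -> M).
Hypothesis s_atoms : enumerates_atoms s.

(** The given map is arbitrary at 1; giving 1 the weight 0 makes the inequality strict for b = 1 as
    well. *)
Lemma strongly_noetherian_weight : strongly_noetherian M ->
  exists lam : M -> nat, forall e a b, a <> 1 -> (lam b < lam (smul e a b))%N.
Proof.
move=> [lam0 [Hpos Hadd]]; exists (fun x => if x == 1 then 0 else lam0 x) => e a b Ha.
have Hab : smul e a b != 1 by apply/eqP => /(smul_conical M_gcd) [].
rewrite (negPf Hab); case: eqVneq => [->|/eqP Hb]; first by rewrite smulx1; apply: Hpos.
case: e {Hab} => /=; last by apply: leq_trans (Hadd _ _ Ha Hb); rewrite addnC -addn1 leq_add2l Hpos.
by apply: leq_trans (Hadd _ _ Hb Ha); rewrite -addn1 leq_add2l Hpos.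
Qed.

Lemma basic_enumeration : finitely_many_basic M ->
  exists tl : seq M, forall e x, sbasic e x -> x \in tl.
Proof.
move=> [[s1 H1] [s2 H2]]; exists (s1 ++ s2) => -[] x Hx; rewrite mem_cat.
  by rewrite (H2 _ Hx) orbT.
by rewrite (H1 _ Hx).
Qed.

(** Each table entry exists or not by excluded middle, and finitely many choices give a function
    that can be built into a machine. *)
Lemma sweep_table (Tk : finType) (tokv : Tk -> M) :
  exists tok : bool -> Tk -> 'I_k -> option (Tk * seq 'I_k),
    (forall e t i t' w, tok e t i = Some (t', w) ->
      smul e (tokv t) (sprod s e w) = smul e (s i) (tokv t') /\
      slcm e (smul e (s i) (tokv t')) (tokv t) (s i)) /\
    (forall e t i, tok e t i = None ->
      forall t' w, smul e (tokv t) (sprod s e w) = smul e (s i) (tokv t') ->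
      ~ slcm e (smul e (s i) (tokv t')) (tokv t) (s i)).
Proof.
pose P e t i t' w := smul e (tokv t) (sprod s e w) = smul e (s i) (tokv t') /\
  slcm e (smul e (s i) (tokv t')) (tokv t) (s i).
have /fin_all_exists [tok Htok] : forall x : bool * Tk * 'I_k,
    exists o : option (Tk * seq 'I_k),
      if o is Some (t', w) then P x.1.1 x.1.2 x.2 t' w
      else forall t' w, ~ P x.1.1 x.1.2 x.2 t' w.
  move=> x; case: (classic (exists t' w, P x.1.1 x.1.2 x.2 t' w)) => [[t' [w H]]|H].
    by exists (Some (t', w)).
  by exists None => t' w H'; apply: H; exists t', w.
exists (fun e t i => tok (e, t, i)); split=> [e t i t' w E|e t i E t' w H1 H2].
  by have := Htok (e, t, i); rewrite E.
by have := Htok (e, t, i); rewrite E => /(_ t' w) [].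
Qed.

End Tables.

(** * Signed words as multifractions *)

Section Encoding.

Variables (M : monoidType) (U : groupType) (iota : M -> U).
Hypothesis iota_morph : monoid_morphism iota.
Variables (k : nat) (s : 'I_k -> M).

(** The words involved have at most one letter, so the direction of reading does not matter. *)
Lemma entries_signed_words w :
  entries s false (signed_words w) = [seq word_value s v | v <- signed_words w].
Proof.
elim: w => //= -[i b] w IH; rewrite /signed_words /= map_cat entries_cat.
have -> : odd (size (letter_words (i, b))) = false by case: b.
rewrite addbF IH; congr (_ ++ _); rewrite /word_value.
by case: b; rewrite /= big_nil big_cons big_nil ?mulg1 ?mul1g.
Qed.

Lemma mf_value_signed_words w :
  mf_value iota [seq word_value s v | v <- signed_words w] = signed_word_value iota s w.
Proof.
rewrite -entries_signed_words /mf_value /signed_word_value.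
elim: w => [|[i b] w IH]; first by rewrite big_nil.
rewrite big_cons -IH /signed_words /=.
by case: b; rewrite /= ?mulg1 ?mul1g !iota_morph.1 ?invg1 ?mul1g.
Qed.

Lemma entries_pad n ws : entries s false (nseq (2 * n) [::] ++ ws) =
  ones M (2 * n) ++ entries s false ws.
Proof.
rewrite entries_cat size_nseq mul2n odd_double addbF; congr (_ ++ _).
by rewrite -mul2n; elim: (2 * n)%N (false) => //= m IH e; rewrite IH.
Qed.

Lemma mf_value_pad n a : mf_value iota (ones M (2 * n) ++ a) = mf_value iota a.
Proof.
elim: n => // n IH; rewrite mulnS /=.
by rewrite -[RHS]IH /mf_value /= iota_morph.1 invg1 !mul1g.
Qed.

End Encoding.

Theorem proposition1p6 (M : monoidType) (U : groupType) (iota : M -> U)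
    (U_enveloping : is_enveloping_group iota)
    (M_gcd : gcd_monoid M)
    (M_noetherian : strongly_noetherian M)
    (M_basic : finitely_many_basic M)
    (f : seq M -> nat)
    (f_computable : mf_turing_computable f)
    (f_padding : semi_convergent_up_to_padding iota f) :
  word_problem_decidable iota.
Proof.
have [iota_morph _] := U_enveloping.
have [k [s [s_atoms [F [FE [T HT]]]]]] := f_computable.
have [lam lam_lt] := strongly_noetherian_weight M_gcd M_noetherian.
have [tl Htl] := basic_enumeration M_basic.
(* One list covers right- and left-basic elements, so the same tokens serve on both sides. *)
pose tokv (t : seq_sub tl) := ssval t.
have tokv_basic e x : sbasic e x -> exists t, tokv t = x.
  by move=> /Htl Hx; exists (SeqSub Hx).
have [tok [tok_some tok_none]] := sweep_table s tokv.
have /fin_all_exists [tk0 tk0E] : forall i, exists t, tokv t = s i.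
  by move=> i; apply: (tokv_basic false); apply/sbasic_atom/s_atom.
have /fin_all_exists [expand0 expand0E] : forall x : bool * seq_sub tl,
    exists w, sprod s x.1 w = tokv x.2.
  by move=> x; exact: (atom_words lam_lt s_atoms).
pose expand e t := expand0 (e, t).
have expandE e t : sprod s e (expand e t) = tokv t by apply: (expand0E (e, t)).
pose tk1 t := tokv t == 1.
exists k, s; split=> //.
exists (fun w => signed_word_value iota s w == 1); split; first by move=> w; split=> /eqP.
(* The list omits [None], which comes first among the choices: by default a trial moves to the
   right. *)
pose cs := map (@Some 'I_k) (enum 'I_k).
have cs_uniq : uniq (None :: cs).
  rewrite /= map_inj_uniq ?enum_uniq ?andbT; last by move=> x y [].
  by apply/negP => /mapP [].
have cs_all c : c \in None :: cs.
  by case: c => [i|]; rewrite inE //=; apply: map_f; rewrite mem_enum.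
have [T' HT'] := @realization _ _ _ _ _ _
  (fun x y (E : input_symbol T x = input_symbol T y) => let: erefl := E in erefl)
  (fun x y (E : output_symbol T x = output_symbol T y) => let: erefl := E in erefl)
  (main_prog tok tk0 tk1 expand T cs) (inl in_tape).
exists T' => w; set ws := signed_words w.
have Hacc := child_wf lam_lt s_atoms tok_some tk0E expand (Some ([::], nseq (2 * F ws) [::] ++ ws)).
have [b Hb Hiff] := searches_decides cs_uniq cs_all Hacc.
have [ts Hts Ho] := ev_main (HT ws) Hb.
suff -> : (signed_word_value iota s w == 1) = b by apply: HT' Hts Ho.
rewrite -(mf_value_signed_words iota_morph s) -/ws; apply/eqP/idP => [H|/Hiff H].
  apply/Hiff.
  apply: (accepts_complete M_gcd lam_lt s_atoms tokv_basic tok_some tok_none tk0E expandE).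
  rewrite entries_pad entries_signed_words FE; exact: f_padding.
rewrite -entries_signed_words -(mf_value_pad iota_morph (F ws)) -entries_pad.
exact: (accepts_sound tok_some expandE iota_morph H).
Qed.
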